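(* Let $c\ge 0$, $\mu>0$, $T>0$, $\rho_0\in(0,1)$ and let $g\ge0$, $\int_0^\infty g=1$, be a fixed kernel shape. Let $P_0$ denote the Hawkes model with parameters $(\mu,\rho_0)$, and let $\mathcal P_T$ be any family of models containing $P_0$ and all models $(\mu,\rho_1)$ with $1-\rho_1=(1+\delta)(1-\rho_0)$, $0<\delta\le 1/2$, $\rho_1>0$ (all with the same $\mu$, the same $g$ and the same starting time $s_0=-cT$). Put $\mathcal I_T=T\mu(1-\rho_0)$. There are constants $a,b>0$, depending only on $c$ and on a lower bound for $\rho_0$, such that for every estimator $\hat\rho$ (a measurable function of the record of $N$ on $[0,T]$) $$\sup_{\mathcal P_T}\mathbb P\Big(\Big|\frac{1-\hat\rho}{1-\rho}-1\Big|\ge a\min\{1,\mathcal I_T^{-1/2}\}\Big)\ge b,$$ where $\rho$ is the branching ratio of the model under which the probability is computed. In particular, if $\mathcal I_T$ stays bounded (along a sequence of such experiments with $\rho_0$ bounded below away from $0$ and $c$ fixed), no estimator of the relative margin is uniformly locally consistent over families containing these perturbations, i.e. no sequence of estimators satisfies $\sup_{\mathcal P_T}\mathbb P\big(|(1-\hat\rho)/(1-\rho)-1|>\varepsilon\big)\to0$ for every $\varepsilon>0$.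
   Context: The Hawkes model $(\mu,\rho)$ with kernel shape $g$, started empty at time $s_0\le0$, is a simple point process $N$ on $(s_0,\infty)$ (no points at or before $s_0$) with stochastic intensity $\lambda(t)=\mu+\rho\int_{(s_0,t)}g(t-s)\,N(\mathrm ds)$, where $\mu>0$ and $0<\rho<1$. It is observed on $[0,T]$. The quantity $1-\rho$ is called the margin. *)

(* Defs.v *)
From HB Require Import structures.
From mathcomp Require Import all_boot all_order all_algebra.
From mathcomp Require Import all_classical all_reals all_analysis.
From mathcomp Require Import measurable_realfun.
Set Implicit Arguments.
Unset Strict Implicit.
Unset Printing Implicit Defensive.
Import Order.TTheory GRing.Theory Num.Theory.
Import numFieldNormedType.Exports.
Local Open Scope classical_set_scope.
Local Open Scope ring_scope.

(* A realization of a simple point process is identified with its locally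
   finite set of points: N(B) is the number of points in B, and the integral
   of f over B with respect to N is the sum of f over the points in B. *)
Record config (R : realType) := Config {
  points :> set R ;
  points_locally_finite : forall a b : R, finite_set (points `&` `[a, b]) }.

HB.instance Definition _ (R : realType) := gen_eqMixin (config R).
HB.instance Definition _ (R : realType) := gen_choiceMixin (config R).

Lemma locally_finite0 (R : realType) (a b : R) :
  finite_set ((set0 : set R) `&` `[a, b]).
Proof. by rewrite set0I. Qed.

HB.instance Definition _ (R : realType) :=
  isPointed.Build (config R) (Config (@locally_finite0 R)).

Lemma locally_finite_restrict (R : realType) (w : config R) (D : set R)
  (a b : R) : finite_set ((w `&` D) `&` `[a, b]).
Proof.
apply: (sub_finite_set _ (points_locally_finite w a b)).
by move=> x [[]].
Qed.

Definition restrict_config (R : realType) (D : set R) (w : config R) : config R :=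
  Config (@locally_finite_restrict R w D).

Definition npoints (R : realType) (B : set R) (w : config R) : \bar R :=
  counting (points w `&` B).

Definition pp_integral (R : realType) (B : set R) (f : R -> \bar R)
  (w : config R) : \bar R := \esum_(s in points w `&` B) f s.

(* The events {N(B) \in C} with B a Borel subset of D and C Borel. *)
Definition count_events (R : realType) (D : set R) : set (set (config R)) :=
  \bigcup_(B in [set B : set R | measurable B /\ B `<=` D])
    preimage_set_system setT (npoints B) measurable.

HB.instance Definition _ (R : realType) := Measurable.copy (config R)
  (g_sigma_algebraType (@count_events R setT)).

(* Internal history of N up to time t. *)
Definition history (R : realType) (t : R) : set (set (config R)) :=
  <<s count_events `]-oo, t] >>.

(* Generators of the predictable sigma-algebra on ]s0, +oo[; processes are
   indexed by all of R but only their values after s0 are ever used. *)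
Definition predictable_rects (R : realType) (s0 : R) :
    set (set (R * config R)) :=
  [set E | exists (s t : R) (A : set (config R)),
    [/\ s0 <= s, history s A & E = `]s, t] `*` A]].

Definition predictable (R : realType) (s0 : R) (C : R * config R -> \bar R) :=
  measurable_fun setT
    (C : g_sigma_algebraType (predictable_rects s0) -> \bar R).

(* lam is a stochastic intensity on ]s0, +oo[, with respect to the internal
   history, of the point process with law P (Bremaud's definition). *)
Definition stochastic_intensity (R : realType) (P : probability (config R) R)
    (s0 : R) (lam : R * config R -> \bar R) : Prop :=
  [/\ (forall x, 0 <= lam x)%E,
      predictable s0 lam,
      {ae P, forall w, forall t : R,
        (\int[lebesgue_measure]_(s in `]s0, t]) lam (s, w) < +oo)%E} &
      forall C : R * config R -> \bar R,
        (forall x, 0 <= C x)%E -> predictable s0 C ->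
        (\int[P]_w pp_integral `]s0, +oo[ (fun s => C (s, w)) w =
         \int[P]_w \int[lebesgue_measure]_(t in `]s0, +oo[)
           (C (t, w) * lam (t, w)))%E].

(* Only the values of g on [0, +oo[ are relevant. *)
Definition kernel_shape (R : realType) (g : R -> R) : Prop :=
  [/\ measurable_fun (`[0, +oo[ : set R) g,
      (forall t, 0 <= t -> 0 <= g t) &
      (\int[lebesgue_measure]_(t in `[0%R, +oo[) (g t)%:E = 1)%E].

Definition hawkes_intensity (R : realType) (mu rho : R) (g : R -> R) (s0 : R)
    (x : R * config R) : \bar R :=
  (mu%:E + rho%:E *
    pp_integral `]s0, x.1[ (fun s => (g (x.1 - s))%:E) x.2)%E.

Definition is_hawkes (R : realType) (mu rho : R) (g : R -> R) (s0 : R)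
    (P : probability (config R) R) : Prop :=
  {ae P, forall w, points w `&` `]-oo, s0] = set0} /\
  stochastic_intensity P s0 (hawkes_intensity mu rho g s0).

Record hawkes_model (R : realType) := HawkesModel {
  hm_mu : R ;
  hm_rho : R ;
  hm_g : R -> R ;
  hm_s0 : R ;
  hm_law : probability (config R) R ;
  hm_mu_gt0 : 0 < hm_mu ;
  hm_rho_gt0 : 0 < hm_rho ;
  hm_rho_lt1 : hm_rho < 1 ;
  hm_kernel : kernel_shape hm_g ;
  hm_s0_le0 : hm_s0 <= 0 ;
  hm_hawkes : is_hawkes hm_mu hm_rho hm_g hm_s0 hm_law }.

Definition contains_model (R : realType) (F : set (hawkes_model R))
    (mu rho : R) (g : R -> R) (s0 : R) : Prop :=
  exists2 M, F M &
    [/\ hm_mu M = mu, hm_rho M = rho, hm_g M = g & hm_s0 M = s0].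

Definition contains_local_perturbations (R : realType)
    (F : set (hawkes_model R)) (mu rho0 : R) (g : R -> R) (s0 : R) : Prop :=
  contains_model F mu rho0 g s0 /\
  forall rho1 delta : R, 0 < delta <= 1 / 2 -> 0 < rho1 ->
    1 - rho1 = (1 + delta) * (1 - rho0) -> contains_model F mu rho1 g s0.

(* Estimators are measurable functions of a configuration, evaluated at the
   record of N on [0, T]. *)
Definition rel_error (R : realType) (T : R) (rhohat : config R -> R)
    (M : hawkes_model R) (w : config R) : R :=
  `| (1 - rhohat (restrict_config `[0, T] w)) / (1 - hm_rho M) - 1 |.

Definition sup_prob (R : realType) (F : set (hawkes_model R))
    (E : hawkes_model R -> set (config R)) : \bar R :=
  ereal_sup [set hm_law M (E M) | M in F].

Definition information (R : realType) (T mu rho0 : R) : R :=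
  T * mu * (1 - rho0).

(* Main.v *)
Require Import Defs.
From HB Require Import structures.
From mathcomp Require Import all_boot all_order all_algebra.
From mathcomp Require Import finmap.
From mathcomp Require Import all_classical all_reals all_analysis.
From mathcomp Require Import measurable_realfun.
From mathcomp Require Import ring lra.
Import Order.TTheory GRing.Theory Num.Theory.
Import numFieldNormedType.Exports.
Local Open Scope classical_set_scope.
Local Open Scope ring_scope.

(** The lower bound is Le Cam's two-point method for the models with branching
    ratios [rho0] and [rho'], where [1 - rho' = (1 + delta) * (1 - rho0)] and
    [delta] is of order [min (1, I^(-1/2))]. An estimate whose relative error is
    below [delta / 3] for one model has relative error at least [delta / 3] for
    the other ([margin_separation]), so it is enough that no event can be
    unlikely under the first model while its complement is unlikely under the
    second ([two_point_bound]). This holds as soon as the relative entropy of the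
    first law with respect to the second is bounded.

    The two intensities [l = mu + rho0 * y] and [l' = mu + rho' * y] are affine in
    the same excitation [y], whence an entropy of at most
    [(rho0 - rho')^2 / rho'] times the mean integral of [y] ([hawkes_entropy]).
    The kernel has mass one, so that integral is at most the number of points,
    whose mean over a time [S - s0] is at most [mu * (S - s0) / (1 - rho0)]
    ([mean_count]). The product is of order [delta^2 * I], hence bounded.

    The laws are known only through their intensities, so the likelihood ratio
    has to be recovered from the compensation formula, which equates the mean of
    a sum over the points with the mean of an integral against the intensity.
    For a configuration with [n] points before time [t], let the weight be
    [exp (int l) / prod l], the product running over the points. Between
    arrivals it grows at the rate [l], and at an arrival it is divided by [l]
    ([weight_path]); in the mean these effects cancel, and the mean weights
    satisfy a recursion in [n] that does not mention [l] ([mean_weightS]). This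
    stays true if all points are required to lie in a Borel set [B]. Two processes
    with intensities [l] and [l'] therefore have the same weighted mass of every
    void event; as points are simple, void events generate all events, and the
    weighted laws coincide ([weighted_law_void]). The quotient of the two weights
    is then the likelihood ratio ([change_of_law]). All terms are finite because
    the integral of [l] is at most [mu * t] plus the number of points.

    The bounded-information statement follows since the rate [min (1, I^(-1/2))]
    is then bounded away from zero. *)

Set Implicit Arguments.
Unset Strict Implicit.
Unset Printing Implicit Defensive.

(** * Counting the points before a given time *)

(** The points strictly between [s0] and [t] are counted, so that the count is
    predictable and a point does not count itself. *)
Definition nbefore {R : realType} (s0 t : R) (w : config R) : nat :=
  #|` fset_set (points w `&` `]s0, t[)|%fset.

Lemma finite_before (R : realType) (s0 t : R) (w : config R) :
  finite_set (points w `&` `]s0, t[).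
Proof.
apply: (sub_finite_set _ (points_locally_finite w s0 t)) => x [wx].
by rewrite /= !in_itv/= => /andP[/ltW -> /ltW ->].
Qed.

Lemma npoints_before (R : realType) (s0 t : R) (w : config R) :
  npoints `]s0, t[ w = (nbefore s0 t w)%:R%:E.
Proof. by rewrite /npoints /counting asboolT//; exact: finite_before. Qed.

Lemma subset_nbefore (R : realType) (s0 t : R) (w : config R) (A : set R) :
  A `<=` points w `&` `]s0, t[ -> (#|` fset_set A| <= nbefore s0 t w)%N.
Proof.
move=> A_sub; have fB := finite_before s0 t w.
by rewrite /nbefore fsubset_leq_card// -fset_set_sub//; exact: sub_finite_set fB.
Qed.

Lemma le_nbefore (R : realType) (s0 t u : R) (w : config R) :
  t <= u -> (nbefore s0 t w <= nbefore s0 u w)%N.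
Proof.
move=> tu; apply: subset_nbefore => x [wx].
by rewrite /= !in_itv/= => /andP[-> /lt_le_trans ->].
Qed.

Lemma nbeforeS (R : realType) (s0 s : R) (w : config R) :
  (nbefore s0 s w).+1 = #|` fset_set (s |` (points w `&` `]s0, s[))|%fset.
Proof.
have fS := finite_before s0 s w.
rewrite fset_setU1// cardfsU1 in_fset_set// memNset//=.
by move=> [_]; rewrite in_itv/= ltxx andbF.
Qed.

Lemma lt_nbefore (R : realType) (s0 s t : R) (w : config R) :
  points w s -> s0 < s -> s < t -> (nbefore s0 s w < nbefore s0 t w)%N.
Proof.
move=> ws s0s st; rewrite nbeforeS.
apply: subset_nbefore => x /= [->|[wx]].
  by split=> //; rewrite in_itv/= s0s.
by rewrite in_itv/= => /andP[s0x xs]; split=> //; rewrite in_itv/= s0x (lt_trans xs).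
Qed.

(** Counting the earlier points maps the [n] points before [t] injectively into
    the numbers below [n], so it is onto. *)
Lemma nbefore_surj (R : realType) (s0 t : R) (w : config R) (k : nat) :
  (k < nbefore s0 t w)%N ->
  exists s, [/\ points w s, s0 < s, s < t & nbefore s0 s w = k].
Proof.
move=> k_lt; set X := fset_set (points w `&` `]s0, t[).
have XP s : s \in X -> [/\ points w s, s0 < s & s < t].
  rewrite in_fset_set ?inE; last exact: finite_before.
  by move=> [ws]; rewrite /= in_itv/= => /andP[].
pose f s := nbefore s0 s w.
have f_inj : {in X &, injective f}.
  move=> s u /XP[ws s0s st] /XP[wu s0u ut]; rewrite /f => fsu.
  have [su|us|//] := ltgtP s u.
    by have := lt_nbefore ws s0s su; rewrite fsu ltnn.
  by have := lt_nbefore wu s0u us; rewrite fsu ltnn.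
pose Y := [fset i | i in iota 0 (nbefore s0 t w)]%fset.
have fXY : ([fset f x | x in X] `<=` Y)%fset.
  apply/fsubsetP => i /imfsetP[/= s /XP[ws s0s st] ->].
  by rewrite in_fset mem_iota/= add0n lt_nbefore.
have cXY : #|` [fset f x | x in X]%fset| = #|` Y|.
  rewrite card_in_imfset// /Y card_imfset//=.
  by rewrite undup_id ?iota_uniq// size_iota.
have /eqP XY : [fset f x | x in X]%fset == Y.
  by rewrite eqEfcard fXY cXY leqnn.
have : k \in Y by rewrite in_fset mem_iota.
rewrite -XY => /imfsetP[/= s /XP[ws s0s st] fs].
by exists s.
Qed.

(** The (k+1)-st point of [w] after [s0]; it is [s0] if there is none. *)
Definition arrival {R : realType} (s0 : R) (k : nat) (w : config R) : R :=
  xget s0 [set s | [/\ points w s, s0 < s & nbefore s0 s w = k]].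

Lemma arrivalP (R : realType) (s0 t : R) (k : nat) (w : config R) :
  (k < nbefore s0 t w)%N ->
  [/\ points w (arrival s0 k w), s0 < arrival s0 k w, arrival s0 k w < t &
      nbefore s0 (arrival s0 k w) w = k].
Proof.
move=> /[dup] k_lt /nbefore_surj[s [ws s0s st sk]].
rewrite /arrival; case: xgetP => [y _ /=[wy s0y yk]|/(_ s)/=]; last first.
  by move=> ns; exfalso; apply: ns.
split=> //; rewrite ltNge; apply/negP => ty.
by have := le_nbefore s0 w ty; rewrite yk leqNgt k_lt.
Qed.

Lemma arrival_uniq (R : realType) (s0 s : R) (w : config R) :
  points w s -> s0 < s -> arrival s0 (nbefore s0 s w) w = s.
Proof.
move=> ws s0s; have s1 : s < s + 1 by rewrite ltrDl.
have [wa s0a _ ka] := arrivalP (lt_nbefore ws s0s s1).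
have [lt|gt|//] := ltgtP (arrival s0 (nbefore s0 s w) w) s.
  by have := lt_nbefore wa s0a lt; rewrite ka ltnn.
by have := lt_nbefore ws s0s gt; rewrite ka ltnn.
Qed.

Lemma lt_nbefore_arrival (R : realType) (s0 t u : R) (k : nat) (w : config R) :
  (k < nbefore s0 t w)%N -> (k < nbefore s0 u w)%N = (arrival s0 k w < u).
Proof.
move=> /arrivalP[wa s0a _ ka]; apply/idP/idP => [|au].
  by move=> /arrivalP[].
by rewrite -[X in (X < _)%N]ka lt_nbefore.
Qed.

(** Exactly one point carries each label, so a sum over the points with label
    [k] has at most one term. *)
Lemma pp_integral_label (R : realType) (s0 t : R) (k : nat) (h : R -> \bar R)
    (w : config R) : (forall s, 0 <= h s)%E ->
  pp_integral `]s0, t[ (fun s => if nbefore s0 s w == k then h s else 0%E) w =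
  if (k < nbefore s0 t w)%N then h (arrival s0 k w) else 0%E.
Proof.
move=> h0; have := @esum_mkcondr R R (points w `&` `]s0, t[)
  [set s | nbefore s0 s w = k] h.
rewrite /pp_integral; under [X in _ = X -> _]eq_esum.
  move=> s _; rewrite (_ : (s \in _) = (nbefore s0 s w == k)); last first.
    by apply/idP/eqP; rewrite inE.
  over.
move=> <-; case: ifPn => [/arrivalP[wa s0a at_ ka]|k_ge].
  rewrite [X in esum X _](_ : _ = [set arrival s0 k w]) ?esum_set1 ?h0//.
  apply/seteqP; split=> [s [[ws]]|_ ->]/=.
    by rewrite in_itv/= => /andP[s0s st] <-; rewrite arrival_uniq.
  by rewrite in_itv/= s0a at_.
rewrite [X in esum X _](_ : _ = set0) ?esum_set0//.
apply/seteqP; split=> // s [[ws]] /=; rewrite in_itv/= => /andP[s0s st] sk.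
by move/negP: k_ge; apply; rewrite -sk lt_nbefore.
Qed.

(** * Predictable functionals of the past *)

Lemma history_measurable (R : realType) (t : R) (A : set (config R)) :
  history t A -> measurable A.
Proof.
apply: smallest_sub; first exact: smallest_sigma_algebra.
move=> B [D [mD _] DB]; apply: sub_sigma_algebra.
by exists D.
Qed.

Lemma history_npoints (R : realType) (t : R) (B : set R) (C : set (\bar R)) :
  measurable B -> B `<=` `]-oo, t] -> measurable C ->
  history t (npoints B @^-1` C).
Proof.
move=> mB Bt mC; apply: sub_sigma_algebra; exists B => //.
by exists C => //; rewrite setTI.
Qed.

Lemma measurable_npoints (R : realType) (B : set R) :
  measurable B -> measurable_fun setT (npoints B).
Proof.
move=> mB _ C mC; rewrite setTI; apply: sub_sigma_algebra; exists B => //.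
by exists C => //; rewrite setTI.
Qed.

Lemma predictable_measurable_set (R : realType) (s0 : R)
    (E : set (R * config R)) :
  <<s predictable_rects s0 >> E -> measurable E.
Proof.
apply: smallest_sub; first exact: sigma_algebra_measurable.
move=> _ [s [t [A [s0s /history_measurable mA ->]]]].
exact: measurableX.
Qed.

(** Times and configurations with the predictable sigma-algebra: measurability
    on this type is predictability. *)
Notation past R s0 := (g_sigma_algebraType (@predictable_rects R s0)).

Lemma predictable_measurable (R : realType) (s0 : R) d (T : measurableType d)
    (f : R * config R -> T) :
  measurable_fun setT (f : past R s0 -> T) -> measurable_fun setT f.
Proof.
by move=> mf _ C mC; apply: (@predictable_measurable_set _ s0); exact: mf.
Qed.

Lemma predictable_after (R : realType) (s0 q : R) (A : set (config R)) :
  s0 <= q -> history q A ->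
  measurable ([set x | q < x.1 /\ A x.2] : set (past R s0)).
Proof.
move=> s0q hA.
rewrite (_ : [set x | _] = \bigcup_n (`]q, q + n%:R] `*` A)).
  apply: bigcupT_measurable => n; apply: sub_sigma_algebra.
  by exists q, (q + n%:R), A.
apply/seteqP; split=> [[t w]/= [qt Aw]|[t w] [n _] []]/=.
  exists (Num.truncn (t - q)).+1 => //; split => //=.
  by rewrite in_itv/= qt -lerBlDl ltW// truncnS_gt.
by rewrite in_itv/= => /andP[].
Qed.

Definition nbefore_in {R : realType} (s0 : R) (B : set R) (t : R)
    (w : config R) : nat :=
  #|` fset_set (points w `&` (`]s0, t[ `&` B))|%fset.

Lemma npoints_fin (R : realType) (s0 t : R) (B : set R) (w : config R) :
  B `<=` `]s0, t] ->
  npoints B w = (#|` fset_set (points w `&` B)|%fset)%:R%:E.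
Proof.
move=> Bs; rewrite /npoints /counting asboolT//.
apply: (sub_finite_set _ (points_locally_finite w s0 t)) => x [wx /Bs].
by rewrite /= !in_itv/= => /andP[/ltW -> ->].
Qed.

(** The count of points in a set before the current time is left-continuous,
    so it is decided by its values at earlier rational times. *)
Lemma predictable_nbefore_in (R : realType) (s0 : R) (B : set R) (k : nat) :
  measurable B ->
  measurable ([set x | (k < nbefore_in s0 B x.1 x.2)%N] : set (past R s0)).
Proof.
move=> mB; pose D (q : R) := `]s0, q] `&` B.
have D_sub q : D q `<=` `]s0, q] by move=> x [].
have mD q : measurable (D q) by exact: measurableI.
rewrite (_ : [set x | _] = \bigcup_(q : rat)
   [set x | s0 <= ratr q /\
     (ratr q < x.1 /\ (k%:R%:E < npoints (D (ratr q)) x.2)%E)]).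
  apply: bigcupT_measurable_rat => q.
  have [s0q|s0q] := leP s0 (ratr q); last first.
    by rewrite (_ : [set x | _] = set0)//; apply/seteqP; split => // x [].
  rewrite (_ : [set x | _] = [set x | ratr q < x.1 /\
      (k%:R%:E < npoints (D (ratr q)) x.2)%E]); last first.
    by apply/seteqP; split => [x []|x []].
  apply: (@predictable_after _ s0 (ratr q)
    [set w | (k%:R%:E < npoints (D (ratr q)) w)%E]) => //.
  rewrite (_ : [set w | _] = npoints (D (ratr q)) @^-1` `]k%:R%:E, +oo[%classic).
    apply: history_npoints => //.
      by move=> x [/=]; rewrite !in_itv/= => /andP[].
    exact: emeasurable_itv.
  by apply/seteqP; split => w /=; rewrite in_itv/= andbT.
apply/seteqP; split=> [[t w]/= k_lt|[t w]/= [q _ /= [s0q [qt]]]].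
  have : (0 < nbefore s0 t w)%N.
    apply: leq_trans (subset_nbefore (_ : _ `<=` _)); last exact: setIS (@subIsetl _ _ B).
    by apply: leq_trans k_lt.
  move=> n_gt0; have := arrivalP (k := (nbefore s0 t w).-1) (s0 := s0) (t := t) (w := w).
  rewrite prednK// leqnn => /(_ isT)[wa s0a at_ na].
  have [q] := rat_in_itvoo at_; rewrite in_itv/= => /andP[aq qt].
  exists q => //=; split; first by rewrite ltW// (lt_trans s0a).
  split => //; rewrite (npoints_fin _ (D_sub _)) lte_fin ltr_nat.
  apply: (leq_trans k_lt); rewrite /nbefore_in fsubset_leq_card//.
  rewrite -fset_set_sub//; last 2 first.
  - by apply: sub_finite_set (finite_before s0 t w); exact: setIS (@subIsetl _ _ B).
  - by apply: sub_finite_set (points_locally_finite w s0 (ratr q)) => x [wx [/=]];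
      rewrite !in_itv/= => /andP[/ltW -> ->].
  move=> x [wx [/=]]; rewrite in_itv/= => /andP[s0x xt] Bx; split=> //; split=> //=.
  rewrite in_itv/= s0x /= leNgt; apply/negP => qx.
  have ax := lt_trans aq qx.
  have := lt_nbefore wx s0x xt; have := lt_nbefore wa s0a ax.
  rewrite na prednK// => h1 h2.
  by have := leq_trans h2 h1; rewrite ltnn.
rewrite (npoints_fin _ (D_sub _)) lte_fin ltr_nat => /leq_trans; apply.
rewrite /nbefore_in fsubset_leq_card// -fset_set_sub//; last 2 first.
- by apply: sub_finite_set (points_locally_finite w s0 (ratr q)) => x [wx [/=]];
    rewrite !in_itv/= => /andP[/ltW -> ->].
- by apply: sub_finite_set (finite_before s0 t w); exact: setIS (@subIsetl _ _ B).
move=> x [wx [/=]]; rewrite !in_itv/= => /andP[s0x xq] Bx; split=> //; split=> //=.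
by rewrite s0x (le_lt_trans xq).
Qed.

Lemma nbefore_in_setT (R : realType) (s0 t : R) (w : config R) :
  nbefore_in s0 setT t w = nbefore s0 t w.
Proof. by rewrite /nbefore_in setIT. Qed.

Lemma predictable_nbefore_gt (R : realType) (s0 : R) (k : nat) :
  measurable ([set x | (k < nbefore s0 x.1 x.2)%N] : set (past R s0)).
Proof.
rewrite (_ : [set x | _] = [set x | (k < nbefore_in s0 setT x.1 x.2)%N]).
  exact: predictable_nbefore_in.
by apply/seteqP; split => x /=; rewrite nbefore_in_setT.
Qed.

Lemma predictable_nbefore_eq (R : realType) (s0 : R) (k : nat) :
  measurable ([set x | nbefore s0 x.1 x.2 = k] : set (past R s0)).
Proof.
case: k => [|k].
  rewrite (_ : [set x | _] = ~` [set x | (0 < nbefore s0 x.1 x.2)%N]).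
    by apply: measurableC; exact: predictable_nbefore_gt.
  by apply/seteqP; split => x /=; [move=> ->|case: nbefore].
rewrite (_ : [set x | _] = [set x | (k < nbefore s0 x.1 x.2)%N] `\`
    [set x | (k.+1 < nbefore s0 x.1 x.2)%N]).
  by apply: measurableD; exact: predictable_nbefore_gt.
apply/seteqP; split => x /=; first by move=> ->; rewrite leqnn ltnn.
by move=> [kn /negP]; rewrite -leqNgt => nk; apply/eqP; rewrite eqn_leq nk.
Qed.

(** Evaluating a predictable functional at the (k+1)-st arrival, once it has
    occurred, is predictable: on a generating rectangle over the interval from
    [a] to [b], the arrival falls in the interval when the count up to [b]
    exceeds [k] and the count up to [a] does not. *)
Lemma predictable_arrival (R : realType) (s0 : R) (k : nat) :
  measurable_fun ([set x | (k < nbefore s0 x.1 x.2)%N] : set (past R s0))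
    ((fun x => (arrival s0 k x.2, x.2)) : past R s0 -> past R s0).
Proof.
set M := [set x | _].
apply: (@measurability _ _ (past R s0) (past R s0) M _ (predictable_rects s0)) => //.
move=> _ [_ [a [b [A [s0a hA ->]]]] <-].
(* the arrival is at most [c] iff more than [k] points are at most [c] *)
have key c (t : R) w : (k < nbefore s0 t w)%N ->
    (arrival s0 k w <= c) = (k < nbefore_in s0 `]-oo, c] t w)%N.
  move=> /arrivalP[wa s0r rt nr].
  have fB : finite_set (points w `&` (`]s0, t[ `&` `]-oo, c])).
    by apply: sub_finite_set (finite_before s0 t w); exact: setIS (@subIsetl _ _ _).
  apply/idP/idP => [rc|].
    rewrite -[X in (X < _)%N]nr nbeforeS.
    have fS := finite_before s0 (arrival s0 k w) w.
    rewrite /nbefore_in fsubset_leq_card// -fset_set_sub//; last first.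
      by rewrite finite_setU; split => //; exact: finite_set1.
    move=> x /= [->|[wx]]; first by rewrite !in_itv/= s0r rt rc.
    rewrite !in_itv/= => /andP[s0x xr]; rewrite s0x (lt_trans xr rt).
    by rewrite (le_trans (ltW xr)).
  rewrite leNgt => k_lt; apply/negP => cr; move: k_lt; rewrite ltnNge => /negP; apply.
  rewrite -[X in (_ <= X)%N]nr; apply: subset_nbefore => x [wx [/=]].
  rewrite !in_itv/= => /andP[s0x xt] xc; split => //.
  by rewrite s0x (le_lt_trans xc).
rewrite (_ : _ `&` _ = M `&` [set x | a < x.1 /\ A x.2] `&`
  [set x | (k < nbefore_in s0 `]-oo, b] x.1 x.2)%N] `\`
  [set x | (k < nbefore_in s0 `]-oo, a] x.1 x.2)%N]).
  apply: measurableD; last exact: predictable_nbefore_in.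
  apply: measurableI; last exact: predictable_nbefore_in.
  by apply: measurableI; [exact: predictable_nbefore_gt|exact: predictable_after].
apply/seteqP; split=> [[t w] [/= kt [/=]]|[t w] [[[/= kt [at_ Aw]]]]].
  rewrite in_itv/= => /andP[ar rb] Aw.
  have [_ _ rt _] := arrivalP kt.
  rewrite -!key// rb; split=> //; last by apply/negP; rewrite -ltNge.
  by split => //; split => //; split => //; exact: lt_trans ar rt.
rewrite -!key// => rb /negP; rewrite -ltNge => ar.
by split => //; split => //=; rewrite in_itv/= ar.
Qed.

Lemma history_setT (R : realType) (t : R) : history t [set: config R].
Proof.
have := sigma_algebraCD (@sigma_algebra0 _ setT (@count_events R `]-oo, t])).
by rewrite setD0.
Qed.

(** The integral of a predictable process up to the current time only needs
    its values at earlier times: on [s0 < s < t] the map [((t, w), s)] to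
    [(s, w)] is measurable for the predictable sigma-algebras, and Tonelli
    then integrates out [s]. *)
Lemma predictable_integral (R : realType) (s0 : R) (l : R * config R -> \bar R) :
  (forall x, 0 <= l x)%E ->
  measurable_fun setT (l : past R s0 -> \bar R) ->
  measurable_fun setT ((fun x =>
    \int[lebesgue_measure]_(s in `]s0, x.1[) l (s, x.2))%E : past R s0 -> \bar R).
Proof.
move=> l0 ml.
pose G : set (past R s0 * R) := [set z | s0 < z.2 < z.1.1].
have mG : measurable G.
  rewrite (_ : G = \bigcup_(q : rat) [set z | s0 <= ratr q /\
     ([set x : past R s0 | ratr q < x.1 /\ True] `*` `]s0, ratr q]) z]).
    apply: bigcupT_measurable_rat => q.
    have [s0q|s0q] := leP s0 (ratr q); last first.
      by rewrite (_ : [set x | _] = set0)//; apply/seteqP; split => // x [].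
    rewrite (_ : [set z | _] =
      ([set x : past R s0 | ratr q < x.1 /\ True] `*` `]s0, ratr q])).
      apply: measurableX => //; apply: (@predictable_after _ s0 (ratr q) setT) => //.
      exact: history_setT.
    by apply/seteqP; split => [x []|x []].
  apply/seteqP; split => [[[t w] s]/= /andP[s0s st]|[[t w] s] [q _ /=]].
    have [q] := rat_in_itvoo st; rewrite in_itv/= => /andP[sq qt].
    exists q => //=; split; first by rewrite ltW// (lt_trans s0s).
    by split=> //; rewrite in_itv/= s0s ltW.
  rewrite in_itv/= => -[_ [[qt _] /andP[s0s sq]]].
  by rewrite /G /= s0s (le_lt_trans sq).
pose psi (z : past R s0 * R) : past R s0 := (z.2, z.1.2).
have mpsi : measurable_fun G psi.
  apply: (@measurability _ _ (past R s0 * R)%type (past R s0) G _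
    (predictable_rects s0)) => //.
  move=> _ [_ [a [b [A [s0a hA ->]]]] <-].
  rewrite (_ : _ `&` _ = G `&`
     ([set x : past R s0 | a < x.1 /\ A x.2] `*` `]a, b])).
    by apply: measurableI => //; apply: measurableX => //; exact: predictable_after.
  apply/seteqP; split => [[[t w] s] [Gz [/= + Aw]]|[[t w] s] [Gz [/= [_ Aw] sab]]].
    move=> /[dup] sab; rewrite in_itv/= => /andP[as_ _]; split => //; split=> //=.
    by move: Gz => /andP[_]; split => //; exact: lt_trans as_ _.
  by split.
have mlpsi : measurable_fun setT ((l \o psi) \_ G).
  apply/(measurable_restrictT _ mG); exact: (@measurable_comp _ _ _ _ (past R s0) _ setT l G psi measurableT).
have lpsi0 z : (0 <= ((l \o psi) \_ G) z)%E by rewrite patchE; case: ifPn => /=.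
have := measurable_fun_fubini_tonelli_F (m2 := @lebesgue_measure R)
  ((l \o psi) \_ G) mlpsi lpsi0.
apply: eq_measurable_fun => -[t w] _; rewrite /fubini_F.
rewrite [RHS]integral_mkcond; apply: eq_integral => s _; rewrite !patchE /=.
by rewrite (_ : ((t, w, s) \in G) = (s \in `]s0, t[%classic))//; apply/idP/idP; rewrite !inE /G/= in_itv/=.
Qed.

Lemma measurable_inv_ge0 d (T : measurableType d) (R : realType) (D : set T)
    (f : T -> R) : (forall x, 0 <= f x) -> measurable_fun D f ->
  measurable_fun D (fun x => (f x)^-1).
Proof.
move=> f0 mf; rewrite (_ : (fun x => _) = (fun x => f x `^ (-1))).
  exact: (measurableT_comp (@measurable_powR R _)).
by apply/funext => x; rewrite powR_inv1.
Qed.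

Lemma predictable_started (R : realType) (s0 : R) :
  measurable ([set x | s0 < x.1] : set (past R s0)).
Proof.
rewrite (_ : [set x | _] = [set x | s0 < x.1 /\ True]).
  by apply: (@predictable_after _ _ s0 setT); [|exact: history_setT].
by apply/seteqP; split => [x ?|x []].
Qed.

Lemma predictable_time (R : realType) (s0 : R) :
  measurable_fun ([set x | s0 < x.1] : set (past R s0)) (fst : past R s0 -> R).
Proof.
apply: (@measurability _ _ (past R s0) R _ _ (@RGenOInfty.G R)).
  exact: RGenOInfty.measurableE.
move=> _ [_ [a ->] <-].
rewrite (_ : _ `&` _ = [set x | Num.max s0 a < x.1 /\ True]).
  apply: (@predictable_after _ _ (Num.max s0 a) setT); last exact: history_setT.
  by rewrite le_max lexx.
apply/seteqP; split=> -[t w] /=; rewrite gt_max in_itv/= andbT.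
  by move=> [-> ->].
by move=> [/andP[]].
Qed.

(** * Janossy weights *)

Section weights.
Context {R : realType} (s0 : R) (l : R * config R -> R) (B : set R).

Definition cumul (t : R) (w : config R) : R :=
  fine (\int[lebesgue_measure]_(s in `]s0, t[) (l (s, w))%:E)%E.

Definition inv_arrivals (n : nat) (w : config R) : R :=
  \prod_(k < n) (\1_B (arrival s0 k w) / l (arrival s0 k w, w)).

(** On configurations with [n] points this is the reciprocal of their Janossy
    density, restricted to points in [B]. Weighting the law of a process of
    intensity [l] by it leaves Lebesgue measure on the simplex of arrival
    times, whatever [l] is. *)
Definition weight (n : nat) (x : R * config R) : R :=
  if nbefore s0 x.1 x.2 == n
  then expR (cumul x.1 x.2) * inv_arrivals n x.2 else 0.

Hypothesis mB : measurable B.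
Hypothesis l_gt0 : forall x, 0 < l x.
Hypothesis ml : measurable_fun setT (l : past R s0 -> R).

Lemma predictable_weight (n : nat) :
  measurable_fun setT (weight n : past R s0 -> R).
Proof.
pose M k : set (past R s0) := [set x | (k < nbefore s0 x.1 x.2)%N].
pose E : set (past R s0) := [set x | nbefore s0 x.1 x.2 = n].
have mE : measurable E by exact: predictable_nbefore_eq.
rewrite (_ : weight n =
  (fun x : past R s0 => expR (cumul x.1 x.2) * inv_arrivals n x.2) \_ E); last first.
  apply/funext => x; rewrite /weight patchE.
  rewrite (_ : (x \in E) = (nbefore s0 x.1 x.2 == n))//.
  by apply/idP/eqP; rewrite inE.
apply/(measurable_restrictT _ mE); apply: measurable_funM.
  apply: (measurableT_comp (@measurable_expR R)); apply: measurable_funTS.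
  apply: (measurableT_comp (fine_measurable measurableT)).
  apply: (@predictable_integral _ s0 (fun x => (l x)%:E)).
    by move=> x; rewrite lee_fin ltW.
  by apply/measurable_EFinP.
apply: measurable_prod => k _.
apply: (@measurable_funS _ _ _ _ (M k)); first exact: predictable_nbefore_gt.
  by move=> x; rewrite /E /M /= => ->.
pose D : set (past R s0) := [set x | s0 < x.1].
have mD : measurable D by exact: predictable_started.
apply: (@measurable_comp _ _ _ _ (past R s0) _ D
   (fun x : past R s0 => \1_B x.1 / l x) _
   (fun x : past R s0 => (arrival s0 k x.2, x.2) : past R s0)) => //.
- by move=> _ [x /arrivalP[_ s0a _ _] <-].
- apply: measurable_funM.
    exact: (measurableT_comp (@measurable_indic _ _ R setT _ mB) (@predictable_time R s0)).
  by apply: measurable_inv_ge0 => [x|]; [exact: ltW|exact: measurable_funTS].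
- exact: predictable_arrival.
Qed.

End weights.

(** * Exponential of an integral *)

(** Bisecting at the midpoint of the range of [phi] halves the bound on the
    increment of [H] and can be repeated. *)
Lemma quadratic_increment_const (R : realType) (phi H : R -> R) (K a b : R) :
  {within `[a, b], continuous phi} ->
  (forall u v, a <= u -> u <= v -> v <= b -> phi u <= phi v) ->
  (forall u v, a <= u -> u <= v -> v <= b ->
    `|H v - H u| <= K * (phi v - phi u) ^+ 2) ->
  forall u v, a <= u -> u <= v -> v <= b -> H u = H v.
Proof.
move=> cphi ndphi HK.
have bisect n : forall u v, a <= u -> u <= v -> v <= b ->
    `|H v - H u| <= K / 2 ^+ n * (phi v - phi u) ^+ 2.
  elim: n => [u v|n IH u v au uv vb]; first by rewrite expr0 divr1; exact: HK.
  have [||c] := @IVT R phi u v ((phi u + phi v) / 2) uv.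
  - apply: continuous_subspaceW cphi => x /=; rewrite !in_itv/= => /andP[ux xv].
    by rewrite (le_trans au)// (le_trans xv).
  - have := ndphi u v au uv vb => puv.
    by rewrite ge_min le_max; apply/andP; split; apply/orP; [left|right]; lra.
  rewrite in_itv/= => /andP[uc cv] phic.
  have H1 := IH u c au uc (le_trans cv vb).
  have H2 := IH c v (le_trans au uc) cv vb.
  rewrite (_ : H v - H u = (H v - H c) + (H c - H u)); last by lra.
  apply: (le_trans (ler_normD _ _)); apply: (le_trans (lerD H2 H1)).
  rewrite phic [2 ^+ n.+1]exprS invfM; set k := 2 ^- n.
  by rewrite le_eqVlt; apply/orP; left; apply/eqP; lra.
move=> u v au uv vb; apply/eqP; rewrite eq_sym -subr_eq0 -normr_le0.
set c := K * (phi v - phi u) ^+ 2.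
have cn n : `|H v - H u| <= c / 2 ^+ n.
  by rewrite /c mulrAC; exact: bisect.
have : (fun n => c * (2^-1) ^+ n) @ \oo --> c * 0.
  by apply: cvgM; [exact: cvg_cst|apply: cvg_expr; rewrite gtr0_norm ?invf_lt1 ?ltr1n// invr_gt0].
rewrite mulr0 => c_cvg.
have <- : lim ((fun n => c * (2^-1) ^+ n) @ \oo) = 0 by apply/cvg_lim.
apply: limr_ge; first by apply: cvgP c_cvg.
by apply: nearW => n; rewrite exprVn; exact: cn.
Qed.

(** Convexity of the exponential encloses [expR q - expR p] between the two
    bounds that are assumed on [j]. *)
Lemma exp_increment_quadratic (R : realType) (p q c j : R) :
  p <= q -> q <= c -> expR p * (q - p) <= j <= expR q * (q - p) ->
  `|j - (expR q - expR p)| <= expR c * (q - p) ^+ 2.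
Proof.
move=> pq qc /andP[l1 u1].
have h (r s : R) : expR r * (1 + (s - r)) <= expR s.
  rewrite [expR s](_ : _ = expR r * expR (s - r)); last by rewrite -expRD addrC subrK.
  by rewrite ler_pM2l ?expR_gt0// expR_ge1Dx.
have l2 : expR p * (q - p) <= expR q - expR p.
  by have := h p q; rewrite mulrDr mulr1; lra.
have u2 : expR q - expR p <= expR q * (q - p).
  by have := h q p; rewrite !mulrDr mulr1; lra.
have e1 : (expR q - expR p) * (q - p) <= expR c * (q - p) ^+ 2.
  rewrite expr2 mulrA ler_wpM2r ?subr_ge0//; apply: (le_trans u2).
  by rewrite ler_wpM2r ?subr_ge0// ler_expR.
apply: le_trans e1; rewrite ler_norml mulrBl.
by apply/andP; split; lra.
Qed.

(** For a merely integrable [f] its primitive [Phi] is continuous but need not be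
    differentiable everywhere, so the chain rule for [expR \o Phi] is obtained
    from increments instead of derivatives. *)
Section exp_primitive.
Context {R : realType} (f : R -> R) (a b : R).
Hypothesis f_ge0 : forall x, 0 <= f x.
Hypothesis mf : measurable_fun setT f.
Hypothesis f_fin : (\int[lebesgue_measure]_(s in `]a, b[) (f s)%:E < +oo)%E.
Hypothesis ab : a <= b.

Let Phi t := fine (\int[lebesgue_measure]_(s in `]a, t[) (f s)%:E)%E.

Let mfE D : measurable_fun D (EFin \o f).
Proof. by apply/measurable_EFinP; exact: measurable_funTS. Qed.

Let fE_ge0 x : (0 <= (f x)%:E)%E.
Proof. by rewrite lee_fin. Qed.

Lemma primitive_fin t : t <= b ->
  (\int[lebesgue_measure]_(s in `]a, t[) (f s)%:E)%E = (Phi t)%:E.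
Proof.
move=> tb; rewrite /Phi fineK// ge0_fin_numE ?integral_ge0//.
apply: le_lt_trans f_fin; apply: ge0_subset_integral => //; first exact: mfE.
by apply: subset_itvl; rewrite bnd_simp.
Qed.

Lemma primitive_incr u v : a <= u -> u <= v -> v <= b ->
  (\int[lebesgue_measure]_(s in `]u, v[) (f s)%:E)%E = (Phi v - Phi u)%:E.
Proof.
move=> au uv vb.
have [->|uv'] := eqVneq u v; first by rewrite subrr set_itvoo0 integral_set0.
have au' : (BRight a <= BRight u)%O by rewrite bnd_simp.
have := primitive_fin vb.
rewrite (@itv_bndbnd_setU _ _ _ (BRight u))//; last first.
  by rewrite bnd_simp lt_neqAle uv'.
rewrite ge0_integral_setU//=; [|exact: mfE|]; last first.
  apply/disj_setPS => x [/=]; rewrite !in_itv/= => /andP[_ xu] /andP[ux _].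
  by move: (lt_le_trans ux xu); rewrite ltxx.
rewrite -integral_itv_bndo_bndc; last exact: mfE.
rewrite (primitive_fin (le_trans uv vb)).
case: (integral _ _ _) => [r| |]//=; rewrite -EFinD => -[] <-.
by rewrite addrC addKr.
Qed.

Lemma primitive_nd u v : a <= u -> u <= v -> v <= b -> Phi u <= Phi v.
Proof.
move=> au uv vb; rewrite -subr_ge0 -lee_fin -primitive_incr//.
exact: integral_ge0.
Qed.

Lemma primitive_continuous : {within `[a, b], continuous Phi}.
Proof.
have intf : lebesgue_measure.-integrable `[a, b] (EFin \o f).
  apply/integrableP; split; first exact: mfE.
  under eq_integral => x _ do rewrite (gee0_abs (fE_ge0 x)).
  by rewrite integral_itv_bndoo//; exact: mfE.
rewrite (_ : Phi = fun x => (\int[lebesgue_measure]_(t in `[a, x]) f t)).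
  exact: parameterized_integral_continuous.
apply/funext => x; rewrite /Phi /Rintegral [in RHS]integral_itv_bndoo//; exact: mfE.
Qed.

Let g s := expR (Phi s) * f s.

Let mgE D : measurable D -> D `<=` `[a, b] -> measurable_fun D (EFin \o g).
Proof.
move=> mD Dab; apply/measurable_EFinP; apply: measurable_funM; last exact: measurable_funTS.
apply: (measurableT_comp (@measurable_expR R)).
apply: (@measurable_funS _ _ _ _ `[a, b]) => //.
by apply: subspace_continuous_measurable_fun => //; exact: primitive_continuous.
Qed.

Let g_bounds u v : a <= u -> u <= v -> v <= b ->
  ((expR (Phi u) * (Phi v - Phi u))%:E <=
    \int[lebesgue_measure]_(s in `]u, v[) (g s)%:E <=
    (expR (Phi v) * (Phi v - Phi u))%:E)%E.
Proof.
move=> au uv vb.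
have uvab : `]u, v[ `<=` `[a, b].
  move=> x /=; rewrite !in_itv/= => /andP[ux xv].
  by rewrite (le_trans au (ltW ux)) (le_trans (ltW xv) vb).
have mg : measurable_fun `]u, v[ (EFin \o g) by exact: mgE.
have mc c : measurable_fun `]u, v[ (fun x => c%:E * (f x)%:E)%E.
  by apply: emeasurable_funM => //; exact: mfE.
have Zl (c : R) : 0 <= c -> ((c * (Phi v - Phi u))%:E =
    \int[lebesgue_measure]_(s in `]u, v[) (c%:E * (f s)%:E))%E.
  move=> c0; rewrite EFinM -primitive_incr// ge0_integralZl_EFin//.
  exact: mfE.
have cf0 (c : R) x : 0 <= c -> (0 <= c%:E * (f x)%:E)%E.
  by move=> c0; rewrite -EFinM lee_fin mulr_ge0.
have g0 x : (0 <= (g x)%:E)%E by rewrite lee_fin mulr_ge0 ?expR_ge0.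
apply/andP; split.
  rewrite [leLHS](Zl (expR (Phi u)) (expR_ge0 _)).
  apply: ge0_le_integral;
    [by []|by move=> x _; exact: cf0 (expR_ge0 _)|exact: mc|exact: mg|move=> x].
  rewrite /= in_itv/= => /andP[ux xv].
  rewrite -EFinM lee_fin; apply: (ler_wpM2r (f_ge0 x)); rewrite ler_expR.
  apply: primitive_nd => //; apply: ltW => //; exact: lt_le_trans xv vb.
rewrite [leRHS](Zl (expR (Phi v)) (expR_ge0 _)).
apply: ge0_le_integral;
  [by []|by move=> x _; exact: g0|exact: mg|exact: mc|move=> x].
rewrite /= in_itv/= => /andP[ux xv].
rewrite -EFinM lee_fin; apply: (ler_wpM2r (f_ge0 x)); rewrite ler_expR.
apply: primitive_nd => //; apply: ltW => //; exact: le_lt_trans au ux.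
Qed.

(** Both [expR \o Phi] and the integral of [expR (Phi s) * f s] have increments
    between [expR (Phi u) * (Phi v - Phi u)] and
    [expR (Phi v) * (Phi v - Phi u)], so that their difference has increments
    quadratic in those of [Phi]. *)
Lemma exp_primitive u v : a <= u -> u <= v -> v <= b ->
  (\int[lebesgue_measure]_(s in `]u, v[) (expR (Phi s) * f s)%:E)%E =
  (expR (Phi v) - expR (Phi u))%:E.
Proof.
pose J t := fine (\int[lebesgue_measure]_(s in `]a, t[) (g s)%:E)%E.
have g_ge0 x : (0 <= (g x)%:E)%E by rewrite lee_fin mulr_ge0// expR_ge0.
have J_fin t : a <= t -> t <= b ->
    (\int[lebesgue_measure]_(s in `]a, t[) (g s)%:E)%E = (J t)%:E.
  move=> at_ tb; rewrite /J fineK// ge0_fin_numE ?integral_ge0//.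
  have /andP[_] := g_bounds (lexx a) at_ tb.
  by move=> /le_lt_trans; apply; rewrite ltry.
have J_incr x y : a <= x -> x <= y -> y <= b ->
    (\int[lebesgue_measure]_(s in `]x, y[) (g s)%:E)%E = (J y - J x)%:E.
  move=> ax xy yb; have ay := le_trans ax xy.
  have [->|xy'] := eqVneq x y; first by rewrite subrr set_itvoo0 integral_set0.
  have ayab : `]a, y[ `<=` `[a, b].
    move=> z /=; rewrite !in_itv/= => /andP[az zy].
    by rewrite (ltW az) (le_trans (ltW zy) yb).
  have ayE : `]a, y[%classic = `]a, x] `|` `]x, y[.
    by rewrite -itv_bndbnd_setU// bnd_simp// lt_neqAle xy'.
  have := J_fin y ay yb; rewrite ayE.
  rewrite ge0_integral_setU//=; [|by apply: mgE; rewrite -ayE|]; last first.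
    apply/disj_setPS => z [/=]; rewrite !in_itv/= => /andP[_ zx] /andP[xz _].
    by move: (lt_le_trans xz zx); rewrite ltxx.
  rewrite -integral_itv_bndo_bndc; last first.
    apply: mgE => // z /=; rewrite !in_itv/= => /andP[az zx].
    by rewrite (ltW az) (le_trans (ltW zx) (le_trans xy yb)).
  rewrite (J_fin _ ax (le_trans xy yb)).
  case: (integral _ _ _) => [r| |]//=; rewrite -EFinD => -[] <-.
  by rewrite addrC addKr.
pose H t := J t - expR (Phi t).
have alg (j1 j2 e1 e2 : R) : (j2 - e2) - (j1 - e1) = (j2 - j1) - (e2 - e1) by lra.
have alg' (j1 j2 e1 e2 : R) : j1 - e1 = j2 - e2 -> j2 - j1 = e2 - e1 by lra.
have HK x y : a <= x -> x <= y -> y <= b ->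
    `|H y - H x| <= expR (Phi b) * (Phi y - Phi x) ^+ 2.
  move=> ax xy yb; have := g_bounds ax xy yb.
  rewrite (J_incr x y ax xy yb) !lee_fin => Jxy.
  have -> : H y - H x = (J y - J x) - (expR (Phi y) - expR (Phi x)).
    exact: alg.
  apply: exp_increment_quadratic Jxy; first exact: primitive_nd.
  by apply: primitive_nd => //; exact: le_trans ax xy.
move=> au uv vb; rewrite (J_incr u v au uv vb); congr EFin.
apply: alg'.
exact: quadratic_increment_const primitive_continuous primitive_nd HK u v au uv vb.
Qed.

End exp_primitive.

Section weight_path.
Context {R : realType} (s0 : R) (l : R * config R -> R) (B : set R).
Hypothesis mB : measurable B.
Hypothesis l_gt0 : forall x, 0 < l x.
Hypothesis ml : measurable_fun setT (l : past R s0 -> R).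
Variables (w : config R) (T : R).
Hypothesis s0T : s0 <= T.
Hypothesis l_fin : (\int[lebesgue_measure]_(s in `]s0, T[) (l (s, w))%:E < +oo)%E.

Let W := weight s0 l B.
Let J n := inv_arrivals s0 l B n w.
Let e t := expR (cumul s0 l t w).

Lemma measurable_path : measurable_fun setT (fun s => l (s, w)).
Proof. exact: (measurable_fun_pair1 w (predictable_measurable ml)). Qed.

Lemma inv_arrivals_ge0 n : 0 <= J n.
Proof.
by apply: prodr_ge0 => k _; rewrite divr_ge0// ltW.
Qed.

Lemma cumul_start : cumul s0 l s0 w = 0.
Proof. by rewrite /cumul set_itvoo0 integral_set0. Qed.

Lemma pp_integral_weight n :
  pp_integral `]s0, T[ (fun s => (W n (s, w))%:E) w =
  if (n < nbefore s0 T w)%N then (e (arrival s0 n w) * J n)%:E else 0%E.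
Proof.
rewrite -(@pp_integral_label _ s0 T n (fun s => (e s * J n)%:E)); last first.
  by move=> s; rewrite lee_fin mulr_ge0 ?expR_ge0 ?inv_arrivals_ge0.
by apply: eq_esum => s _; rewrite /W /weight /=; case: ifP.
Qed.

Lemma pp_integral_next_weight n :
  pp_integral `]s0, T[ (fun s => (W n (s, w) * (\1_B s / l (s, w)))%:E) w =
  if (n < nbefore s0 T w)%N then (e (arrival s0 n w) * J n.+1)%:E else 0%E.
Proof.
have -> : e (arrival s0 n w) * J n.+1 = e (arrival s0 n w) * J n *
    (\1_B (arrival s0 n w) / l (arrival s0 n w, w)).
  by rewrite /J {1}/inv_arrivals big_ord_recr -mulrA.
rewrite -(@pp_integral_label _ s0 T n
  (fun s => (e s * J n * (\1_B s / l (s, w)))%:E)); last first.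
  by move=> s; rewrite lee_fin !mulr_ge0 ?expR_ge0 ?inv_arrivals_ge0// invr_ge0 ltW.
by apply: eq_esum => s _; rewrite /W /weight /=; case: ifP => //; rewrite mul0r.
Qed.

(** The period with [n] points, outside which [W n] vanishes, begins here. *)
Let start n := if n is k.+1 then arrival s0 k w else s0.

Let start_itv n : (n <= nbefore s0 T w)%N -> s0 <= start n <= T.
Proof.
case: n => [|k] /=; first by rewrite lexx.
by move=> /arrivalP[_ a1 a2 _]; rewrite !ltW.
Qed.

Let start_lt n t : (n <= nbefore s0 T w)%N -> s0 < t ->
  (n <= nbefore s0 t w)%N = (start n < t).
Proof.
case: n => [_ ->//|k kT s0t]; exact: (@lt_nbefore_arrival _ s0 T t k w kT).
Qed.

Let integral_gap n t b : (n <= nbefore s0 T w)%N -> start n <= t -> t <= T ->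
  (forall s, (s0 < s < T) && (nbefore s0 s w == n) =
    (s \in Interval (BRight (start n)) (BSide b t))) ->
  (\int[lebesgue_measure]_(s in `]s0, T[) (W n (s, w) * l (s, w))%:E)%E =
  (J n * (e t - e (start n)))%:E.
Proof.
move=> nT st tT windowE.
have /andP[s0n _] := start_itv nT.
have gap := exp_primitive (fun s => ltW (l_gt0 (s, w))) measurable_path l_fin s0T.
have J0 := inv_arrivals_ge0 n.
rewrite EFinM -(gap _ _ s0n st tT).
have mg D : measurable D -> D `<=` `[s0, T] ->
    measurable_fun D (fun s => (e s * l (s, w))%:E).
  move=> mD DT; apply/measurable_EFinP; apply: measurable_funM; last first.
    by apply: measurable_funTS; exact: measurable_path.
  apply: (measurableT_comp (@measurable_expR R)).
  apply: (@measurable_funS _ _ _ _ `[s0, T]) => //.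
  apply: subspace_continuous_measurable_fun => //.
  exact: primitive_continuous (fun s => ltW (l_gt0 (s, w))) measurable_path l_fin s0T.
have sub b' : [set` Interval (BRight (start n)) (BSide b' t)] `<=` `[s0, T].
  move=> s; rewrite /= itv_boundlr => /andP[h1 h2]; rewrite in_itv/=; apply/andP; split.
    by apply: (le_trans s0n); move: h1; rewrite bnd_simp => /ltW.
  by apply: le_trans tT; case: b' h2 => /=; rewrite bnd_simp// => /ltW.
rewrite -(@integral_itv_bndoo _ (start n) t _ false b); last by apply: mg => //; exact: (sub true).
rewrite -ge0_integralZl_EFin//; last 2 first.
- by move=> s _; rewrite lee_fin mulr_ge0 ?expR_ge0// ltW.
- by apply: mg => //; exact: (sub b).
rewrite [LHS]integral_mkcond [RHS]integral_mkcond; apply: eq_integral => s _.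
rewrite !patchE -EFinM.
have -> : (s \in [set` Interval (BRight (start n)) (BSide b t)]) =
    (s0 < s < T) && (nbefore s0 s w == n).
  by rewrite windowE; apply/idP/idP => [/set_mem//|?]; apply/mem_set.
rewrite (_ : (s \in `]s0, T[%classic) = (s0 < s < T)); last first.
  by apply/idP/idP => [/set_mem|h]; [|apply/mem_set]; rewrite /= in_itv.
case: (s0 < s < T) => //=; rewrite /W /weight /=; case: ifP => _; last by rewrite mul0r.
by rewrite mulrA [J n * _]mulrC.
Qed.

(** The process [W n] is zero until the count reaches [n], then grows like the
    exponential of the integrated intensity, and drops back to zero at the
    next arrival. *)
Lemma weight_path n :
  ((W n (T, w))%:E + pp_integral `]s0, T[ (fun s => (W n (s, w))%:E) w =
   (if (n <= nbefore s0 T w)%N then e (start n) * J n else 0)%:E +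
   \int[lebesgue_measure]_(s in `]s0, T[) (W n (s, w) * l (s, w))%:E)%E.
Proof.
rewrite pp_integral_weight {1}/W /weight /=.
have alg (x y z : R) : x * y = z * y + y * (x - z).
  by rewrite mulrBr addrC [z * _]mulrC subrK mulrC.
have [nT|nT|nT] := ltngtP n (nbefore s0 T w).
- have [wa s0a aT na] := arrivalP nT.
  have nT' := ltnW nT.
  have sa : start n <= arrival s0 n w by rewrite ltW// -start_lt// na.
  rewrite (@integral_gap n (arrival s0 n w) false)// ?(ltW aT)//.
    rewrite add0e -EFinD; congr EFin.
    exact: alg.
  move=> s; rewrite itv_boundlr !bnd_simp.
  have [s0s|s0s] /= := ltP s0 s; last first.
    have /andP[s0n _] := start_itv nT'.
    by apply/esym/negbTE; rewrite negb_and -leNgt (le_trans s0s s0n).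
  have -> : (s <= arrival s0 n w) = (nbefore s0 s w <= n)%N.
    by rewrite leNgt -(@lt_nbefore_arrival _ s0 T s n w nT) -leqNgt.
  rewrite -start_lt// [(n <= _)%N && _]andbC -eqn_leq andbC.
  have [sn|//] := eqVneq (nbefore s0 s w) n.
  rewrite /= ltNge; apply/negP => Ts; have := le_nbefore s0 w Ts.
  by rewrite sn leqNgt nT.
- rewrite !add0e integral0_eq//.
  move=> s; rewrite /= in_itv/= => /andP[_ sT]; rewrite /W /weight /=.
  rewrite ifF ?mul0r//; apply/negbTE; rewrite neq_ltn.
  by rewrite (leq_ltn_trans (le_nbefore s0 w (ltW sT)) nT).
- have nT' : (n <= nbefore s0 T w)%N by rewrite nT.
  have /andP[s0n nT0] := start_itv nT'.
  rewrite (@integral_gap n T true)//.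
    rewrite adde0 -EFinD; congr EFin.
    exact: alg.
  move=> s; rewrite itv_boundlr !bnd_simp.
  have [s0s|s0s] /= := ltP s0 s; last first.
    by apply/esym/negbTE; rewrite negb_and -leNgt (le_trans s0s s0n).
  rewrite -start_lt//; have [sT|//] := ltP s T; last by rewrite andbF.
  rewrite andbT eqn_leq; have := le_nbefore s0 w (ltW sT); rewrite -nT => ->.
  by [].
Qed.

End weight_path.

(** * Expectation of the weights *)

Section local_intensity.
Context {R : realType} (P : probability (config R) R) (s0 : R).
Variable lam : R * config R -> \bar R.
Hypothesis intensity : forall C : R * config R -> \bar R,
  (forall x, 0 <= C x)%E -> predictable s0 C ->
  (\int[P]_w pp_integral `]s0, +oo[ (fun s => C (s, w)) w =
   \int[P]_w \int[lebesgue_measure]_(t in `]s0, +oo[) (C (t, w) * lam (t, w)))%E.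

Lemma predictable_window (T : R) :
  measurable ([set x | s0 < x.1 < T] : set (past R s0)).
Proof.
have mD : measurable ([set x | s0 < x.1] : set (past R s0)).
  exact: predictable_started.
have := @predictable_time R s0 mD `]-oo, T[%classic (measurable_itv _).
rewrite (_ : _ `&` _ = [set x | s0 < x.1 < T])//.
apply/seteqP; split => x /=; rewrite in_itv/=; first by move=> [-> ->].
by move=> /andP[-> ->].
Qed.

(** A process only has to be predictable on the window over which it is
    integrated. *)
Lemma local_intensity (T : R) (C : R * config R -> \bar R) :
  (forall x, 0 <= C x)%E ->
  measurable_fun ([set x | s0 < x.1 < T] : set (past R s0)) C ->
  (\int[P]_w pp_integral `]s0, T[ (fun s => C (s, w)) w =
   \int[P]_w \int[lebesgue_measure]_(t in `]s0, T[) (C (t, w) * lam (t, w)))%E.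
Proof.
move=> C0 mC; pose D : set (R * config R) := [set x | s0 < x.1 < T].
have inD s w : ((s, w) \in D) = (s \in `]s0, T[%classic).
  by apply/idP/idP => /set_mem h; apply/mem_set; move: h; rewrite /D/= in_itv.
have := intensity (C := C \_ D).
have D0 x : (0 <= (C \_ D) x)%E by rewrite patchE; case: ifPn.
have mCD : predictable s0 (C \_ D).
  exact: ((@measurable_restrictT _ _ (past R s0) _ _ C (predictable_window T)).1 mC).
move=> /(_ D0 mCD).
have -> : (fun w : config R => pp_integral `]s0, +oo[ (fun s => (C \_ D) (s, w)) w) =
    (fun w : config R => pp_integral `]s0, T[ (fun s => C (s, w)) w).
  apply/funext => w; rewrite /pp_integral.
  have -> : points w `&` `]s0, T[%classic =
    (points w `&` `]s0, +oo[%classic) `&` `]s0, T[%classic.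
    rewrite -setIA; congr (_ `&` _); apply/seteqP; split=> x /=.
      by move=> h; split => //; move: h; rewrite !in_itv/= => /andP[->].
    by move=> [].
  by rewrite [RHS]esum_mkcondr; apply: eq_esum => s _; rewrite patchE inD.
move=> ->; apply: eq_integral => w _.
rewrite [LHS]integral_mkcond [RHS]integral_mkcond; apply: eq_integral => s _.
rewrite !patchE inD; case: (boolP (s \in `]s0, T[%classic)) => [/set_mem|_].
  rewrite /= in_itv/= => /andP[s0s _]; rewrite mem_set//=.
  by rewrite in_itv/= s0s.
by rewrite mul0e; case: ifP.
Qed.

End local_intensity.

Lemma predictable_at_arrival (R : realType) (s0 T : R) (n : nat) (h : R * config R -> \bar R) :
  measurable_fun ([set x | s0 < x.1 < T] : set (past R s0)) h ->
  measurable_fun setT (fun w => if (n < nbefore s0 T w)%N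
     then h (arrival s0 n w, w) else 0%E).
Proof.
move=> mh.
pose D : set (past R s0) := [set x | s0 < x.1 < T].
pose M : set (past R s0) := [set x | (n < nbefore s0 x.1 x.2)%N].
have mM : measurable M by exact: predictable_nbefore_gt.
have mhD : measurable_fun setT (h \_ D : past R s0 -> \bar R).
  exact: ((@measurable_restrictT _ _ (past R s0) _ _ h (@predictable_window R s0 T)).1 mh).
have mc : measurable_fun M
   ((fun x => (h \_ D) (arrival s0 n x.2, x.2)) : past R s0 -> \bar R).
  exact: (@measurable_comp _ _ _ _ (past R s0) _ setT (h \_ D : past R s0 -> _) M
    (fun x : past R s0 => (arrival s0 n x.2, x.2) : past R s0)
    measurableT (@subsetT _ _) mhD (@predictable_arrival R s0 n)).
have mcM := (@measurable_restrictT _ _ (past R s0) _ _ _ mM).1 mc.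
have := measurable_fun_pair2 T (predictable_measurable mcM).
apply: eq_measurable_fun => w _; rewrite patchE.
rewrite (_ : ((T, w) \in M) = (n < nbefore s0 T w)%N); last first.
  by apply/idP/idP => [/set_mem//|?]; apply/mem_set.
case: ifPn => // nT; rewrite patchE mem_set//.
by have [_ a1 a2 _] := arrivalP nT; rewrite /D /= a1 a2.
Qed.

Section mean_weight.
Context {R : realType} (P : probability (config R) R) (s0 mu : R).
Context (l : R * config R -> R) (B : set R).
Hypothesis mB : measurable B.
Hypothesis mu_gt0 : 0 < mu.
Hypothesis mu_le : forall x, mu <= l x.
Hypothesis ml : measurable_fun setT (l : past R s0 -> R).
Hypothesis l_int : forall T w, s0 <= T ->
  (\int[lebesgue_measure]_(s in `]s0, T[) (l (s, w))%:E <=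
   (mu * (T - s0) + (nbefore s0 T w)%:R)%:E)%E.
Hypothesis intensity : forall C : R * config R -> \bar R,
  (forall x, 0 <= C x)%E -> predictable s0 C ->
  (\int[P]_w pp_integral `]s0, +oo[ (fun s => C (s, w)) w =
   \int[P]_w \int[lebesgue_measure]_(t in `]s0, +oo[) (C (t, w) * (l (t, w))%:E))%E.

Let l_gt0 x : 0 < l x. Proof. exact: lt_le_trans (mu_le x). Qed.

Let l_fin T w : s0 <= T ->
  (\int[lebesgue_measure]_(s in `]s0, T[) (l (s, w))%:E < +oo)%E.
Proof. by move=> s0T; apply: le_lt_trans (l_int w s0T) _; rewrite ltry. Qed.

Local Notation W := (weight s0 l B).

Lemma weight_ge0 n x : 0 <= W n x.
Proof.
rewrite /weight; case: ifP => // _.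
by rewrite mulr_ge0 ?expR_ge0 ?inv_arrivals_ge0.
Qed.

Definition weight_bound n T : R := expR (mu * (T - s0) + n%:R) * mu^-1 ^+ n.

Lemma inv_arrivals_le n w : inv_arrivals s0 l B n w <= mu^-1 ^+ n.
Proof.
rewrite /inv_arrivals -[n in leRHS]card_ord -prodr_const.
apply: ler_prod => k _; apply/andP; split; first by rewrite divr_ge0// ltW.
rewrite -[leRHS]mul1r; apply: ler_pM => //; first by rewrite invr_ge0 ltW.
by rewrite lef_pV2 ?posrE.
Qed.

(** The growth of the integrated intensity is controlled by the number of
    points, so the weight of a fixed number of points is bounded. *)
Lemma weight_le n t T w : s0 <= t -> t <= T -> W n (t, w) <= weight_bound n T.
Proof.
move=> s0t tT; rewrite /weight /=; case: eqP => [nt|_]; last first.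
  by rewrite mulr_ge0 ?expR_ge0 ?exprn_ge0// invr_ge0 ltW.
rewrite ler_pM ?expR_ge0 ?inv_arrivals_ge0 ?inv_arrivals_le// ler_expR.
have : ((cumul s0 l t w)%:E <= (mu * (t - s0) + n%:R)%:E)%E.
  rewrite /cumul fineK -?nt; first exact: l_int.
  by rewrite ge0_fin_numE ?l_fin// integral_ge0// => s _; rewrite lee_fin ltW.
rewrite lee_fin => /le_trans; apply.
by rewrite lerD2r; apply: ler_wpM2l; [exact: ltW|rewrite lerD2r].
Qed.

Definition mean_weight n T : \bar R := (\int[P]_w (W n (T, w))%:E)%E.

Let mW n : measurable_fun setT (W n : past R s0 -> R).
Proof. exact: predictable_weight. Qed.

Let mWT n T : measurable_fun setT (fun w => (W n (T, w))%:E).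
Proof.
apply/measurable_EFinP.
exact: (measurable_fun_pair2 T (predictable_measurable (mW n))).
Qed.

Let mB_window T : measurable_fun ([set x | s0 < x.1 < T] : set (past R s0))
  (fun x : past R s0 => \1_B x.1 : R).
Proof.
apply: (@measurable_funS _ _ _ _ ([set x | s0 < x.1] : set (past R s0))).
- exact: predictable_started.
- by move=> x /= /andP[].
- exact: (measurableT_comp (@measurable_indic _ _ R setT _ mB) (@predictable_time R s0)).
Qed.

Let V n T w : \bar R :=
  pp_integral `]s0, T[ (fun s => (W n (s, w) * (\1_B s / l (s, w)))%:E) w.

Let mean_V n T : s0 <= T ->
  (\int[P]_w V n T w =
   \int[lebesgue_measure]_(s in `]s0, T[) ((\1_B s)%:E * mean_weight n s))%E.
Proof.
move=> s0T; rewrite /V.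
rewrite (local_intensity (lam := EFin \o l) intensity (T := T)
    (C := fun x => (W n x * (\1_B x.1 / l x))%:E)); last 2 first.
- by move=> x; rewrite lee_fin mulr_ge0 ?weight_ge0// divr_ge0// ltW.
- apply/measurable_EFinP; apply: measurable_funM; first exact: measurable_funTS.
  apply: measurable_funM => //; apply: measurable_inv_ge0 => [x|]; first exact: ltW.
  exact: measurable_funTS.
pose f (z : config R * R) : \bar R :=
  ((\1_`]s0, T[ z.2)%:E * (\1_B z.2 * W n (z.2, z.1))%:E)%E.
have f0 z : (0 <= f z)%E.
  by rewrite /f -EFinM lee_fin !mulr_ge0 ?weight_ge0.
have mf : measurable_fun setT f.
  apply: emeasurable_funM; apply/measurable_EFinP.
    by apply: (measurableT_comp (@measurable_indic _ _ R setT _ _)) => //; exact: measurable_snd.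
  apply: measurable_funM.
    by apply: (measurableT_comp (@measurable_indic _ _ R setT _ _)) => //; exact: measurable_snd.
  apply: (measurableT_comp (predictable_measurable (mW n))).
  exact: measurable_swap.
transitivity (\int[P]_w \int[lebesgue_measure]_s f (w, s))%E.
  apply: eq_integral => w _; rewrite [LHS]integral_mkcond; apply: eq_integral => s _.
  rewrite patchE /f /= [\1_`]_, _[%classic s]indicE; case: (_ \in _); last by rewrite mul0e.
  rewrite mul1e -EFinM; congr EFin.
  by rewrite -!mulrA mulVf ?mulr1 1?mulrC// gt_eqF.
rewrite (fubini_tonelli (m1 := P) (m2 := @lebesgue_measure R) f mf f0).
rewrite [RHS]integral_mkcond; apply: eq_integral => s _.
rewrite patchE /f /= [\1_`]_, _[%classic s]indicE; case: (_ \in _) => /=; last first.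
  by under eq_integral do rewrite mul0e; rewrite integral0.
under eq_integral do rewrite mul1e EFinM.
by rewrite ge0_integralZl_EFin// => w _; rewrite lee_fin weight_ge0.
Qed.

(** In [weight_path] the sum over the points and the integral have the same
    mean, because the weight is predictable; as that mean is finite, the two
    cancel. *)
Let bookkeeping n T (v : config R -> \bar R) : s0 <= T ->
  (forall w, 0 <= v w)%E -> measurable_fun setT v ->
  (forall w, (W n (T, w))%:E + pp_integral `]s0, T[ (fun s => (W n (s, w))%:E) w =
     v w + \int[lebesgue_measure]_(s in `]s0, T[) (W n (s, w) * l (s, w))%:E)%E ->
  mean_weight n T = (\int[P]_w v w)%E.
Proof.
move=> s0T v0 mv path.
pose p w := pp_integral `]s0, T[ (fun s => (W n (s, w))%:E) w.
pose q w := (\int[lebesgue_measure]_(s in `]s0, T[) (W n (s, w) * l (s, w))%:E)%E.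
have p0 w : (0 <= p w)%E.
  by apply: esum_ge0 => s _; rewrite lee_fin weight_ge0.
have q0 w : (0 <= q w)%E.
  by apply: integral_ge0 => s _; rewrite lee_fin mulr_ge0 ?weight_ge0// ltW.
have mp : measurable_fun setT p.
  have := @predictable_at_arrival R s0 T n (EFin \o W n).
  have mE : measurable_fun ([set x | s0 < x.1 < T] : set (past R s0)) (EFin \o W n).
    by apply/measurable_EFinP; exact: measurable_funTS.
  move=> /(_ mE); apply: eq_measurable_fun => w _.
  rewrite /p pp_integral_weight//; case: ifPn => // /arrivalP[_ _ _ na].
  by rewrite /= /weight /= na eqxx.
have mq : measurable_fun setT q.
  have h0 x : (0 <= (W n x * l x)%:E)%E.
    by rewrite lee_fin mulr_ge0 ?weight_ge0// ltW.
  have mh : measurable_fun setT ((fun x => (W n x * l x)%:E) : past R s0 -> \bar R).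
    by apply/measurable_EFinP; apply: measurable_funM.
  exact: (measurable_fun_pair2 T (predictable_measurable (predictable_integral h0 mh))).
have pq : (\int[P]_w p w = \int[P]_w q w)%E.
  rewrite /p (local_intensity (lam := EFin \o l) intensity (T := T)
    (C := EFin \o W n)); first by [].
  - by move=> x; rewrite lee_fin weight_ge0.
  - by apply/measurable_EFinP; exact: measurable_funTS.
have p_le w : (p w <= (weight_bound n T)%:E)%E.
  rewrite /p pp_integral_weight//; case: ifPn => [/arrivalP[_ a1 a2 na]|_].
    rewrite lee_fin; apply: le_trans (@weight_le n _ T w (ltW a1) (ltW a2)).
    by rewrite /weight /= na eqxx.
  by rewrite lee_fin mulr_ge0 ?expR_ge0 ?exprn_ge0// invr_ge0 ltW.
have p_fin : (\int[P]_w p w \is a fin_num)%E.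
  rewrite ge0_fin_numE; last exact: integral_ge0.
  apply: (@le_lt_trans _ _ (\int[P]_w (cst (weight_bound n T)%:E w))%E).
    by apply: ge0_le_integral => // w _; apply: le_trans (p_le w).
  rewrite integral_cst// [X in (_ * X)%E](_ : _ = 1%E); last exact: probability_setT.
  by rewrite mule1 ltry.
have : (mean_weight n T + \int[P]_w p w = \int[P]_w v w + \int[P]_w p w)%E.
  rewrite {2}pq -!ge0_integralD//; last first.
  - by move=> w _; rewrite lee_fin weight_ge0.
  by apply: eq_integral => w _; exact: path.
by move=> /(congr1 (fun z => z - \int[P]_w p w)%E); rewrite !addeK.
Qed.

Lemma mean_weight0 T : s0 <= T -> mean_weight 0 T = 1%E.
Proof.
move=> s0T; rewrite (bookkeeping s0T (v := cst 1%E))//.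
  rewrite integral_cst// [X in (_ * X)%E](_ : _ = 1%E); last exact: probability_setT.
  by rewrite mule1.
move=> w; rewrite (weight_path B l_gt0 ml s0T (l_fin w s0T)).
by rewrite leq0n cumul_start expR0 /inv_arrivals big_ord0 mulr1.
Qed.

(** The last arrival contributes its intensity, which the weight divides out:
    the recursion does not involve the intensity any more. *)
Lemma mean_weightS n T : s0 <= T ->
  mean_weight n.+1 T =
  (\int[lebesgue_measure]_(s in `]s0, T[) ((\1_B s)%:E * mean_weight n s))%E.
Proof.
move=> s0T; rewrite -mean_V//; apply: bookkeeping => //.
- move=> w; apply: esum_ge0 => s _.
  by rewrite lee_fin mulr_ge0 ?weight_ge0// divr_ge0// ltW.
- have := @predictable_at_arrival R s0 T n (fun x => (W n x * (\1_B x.1 / l x))%:E).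
  have mE : measurable_fun ([set x | s0 < x.1 < T] : set (past R s0))
      (fun x => (W n x * (\1_B x.1 / l x))%:E).
    apply/measurable_EFinP; apply: measurable_funM; first exact: measurable_funTS.
    apply: measurable_funM => //; apply: measurable_inv_ge0 => [x|]; first exact: ltW.
    exact: measurable_funTS.
  move=> /(_ mE); apply: eq_measurable_fun => w _.
  rewrite /V pp_integral_next_weight//; case: ifPn => // /arrivalP[_ _ _ na].
  rewrite /weight /= na eqxx -mulrA; congr ((_ * _)%:E).
  by rewrite [RHS]/inv_arrivals big_ord_recr.
- move=> w; rewrite (weight_path B l_gt0 ml s0T (l_fin w s0T)) /V.
  by rewrite pp_integral_next_weight//; case: ifP.
Qed.

End mean_weight.

(** * The law is determined by the intensity *)

(** The properties of a Hawkes intensity on which the change of law rests: the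
    lower bound and the growth of the integral make the weights bounded, and
    locality makes them functions of the observed points. *)
Record bounded_intensity (R : realType) (P : probability (config R) R)
    (s0 mu : R) (l : R * config R -> R) : Prop := BoundedIntensity {
  bi_gt0 : 0 < mu ;
  bi_ge : forall x, mu <= l x ;
  bi_predictable : measurable_fun setT (l : past R s0 -> R) ;
  bi_local : forall t w w',
    points w `&` `]s0, t[ = points w' `&` `]s0, t[ -> l (t, w) = l (t, w') ;
  bi_integral : forall T w, s0 <= T ->
    (\int[lebesgue_measure]_(s in `]s0, T[) (l (s, w))%:E <=
     (mu * (T - s0) + (nbefore s0 T w)%:R)%:E)%E ;
  bi_intensity : forall C : R * config R -> \bar R,
    (forall x, 0 <= C x)%E -> predictable s0 C ->
    (\int[P]_w pp_integral `]s0, +oo[ (fun s => C (s, w)) w =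
     \int[P]_w \int[lebesgue_measure]_(t in `]s0, +oo[)
       (C (t, w) * (l (t, w))%:E))%E }.

(** Both families of mean weights obey the same recursion. *)
Lemma mean_weight_eq (R : realType) (P P' : probability (config R) R)
    (s0 mu : R) (l l' : R * config R -> R) (B : set R) :
  measurable B -> bounded_intensity P s0 mu l -> bounded_intensity P' s0 mu l' ->
  forall n T, s0 <= T -> mean_weight P s0 l B n T = mean_weight P' s0 l' B n T.
Proof.
move=> mB [mu0 h1 h2 _ h3 h4] [_ h1' h2' _ h3' h4'].
elim=> [|n IH] T s0T.
  by rewrite (mean_weight0 mB mu0 h1 h2 h3 h4)// (mean_weight0 mB mu0 h1' h2' h3' h4').
rewrite (mean_weightS mB mu0 h1 h2 h3 h4)// (mean_weightS mB mu0 h1' h2' h3' h4')//.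
apply: eq_integral => s /set_mem; rewrite /= in_itv/= => /andP[s0s _].
by rewrite IH// ltW.
Qed.

Lemma measurable_count (R : realType) (s0 T : R) (n : nat) :
  measurable [set w : config R | nbefore s0 T w = n].
Proof.
have := measurable_xsection T
  (predictable_measurable_set (@predictable_nbefore_eq R s0 n)).
rewrite (_ : xsection _ _ = [set w | nbefore s0 T w = n])//.
by apply/seteqP; split => w /=; rewrite /xsection /= inE.
Qed.

Definition void {R : realType} (D : set R) : set (config R) :=
  [set w | points w `&` D = set0].

Definition void_events {R : realType} (s0 T : R) : set (set (config R)) :=
  [set void D | D in [set D | measurable D /\ D `<=` `]s0, T[]].

Lemma measurable_void (R : realType) (D : set R) (s0 T : R) :
  measurable D -> D `<=` `]s0, T[ -> measurable (void D).
Proof.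
move=> mD DT; rewrite (_ : void D = npoints D @^-1` [set 0%E]).
  by rewrite -[X in measurable X]setTI; exact: measurable_npoints.
have fD w : finite_set (points w `&` D).
  by apply: sub_finite_set (finite_before s0 T w); exact: setIS.
apply/seteqP; split => w /=; rewrite /void /npoints /counting /= asboolT//.
  by move=> ->; rewrite fset_set0.
by move=> [] /eqP; rewrite pnatr_eq0 cardfs_eq0 => /eqP/fset_set_set0; exact.
Qed.

(** Restricting all arrivals to the complement of [D] restricts to the event
    that [D] is void. *)
Lemma weight_void (R : realType) (s0 T : R) (l : R * config R -> R) (D : set R)
    (n : nat) (w : config R) : D `<=` `]s0, T[ ->
  weight s0 l (~` D) n (T, w) = \1_(void D) w * weight s0 l setT n (T, w).
Proof.
move=> DT; rewrite /weight /=; case: eqP => [nT|_]; last by rewrite mulr0.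
rewrite mulrCA; congr (_ * _).
have [vw|nvw] := pselect (void D w).
  rewrite indicE mem_set// mul1r; apply: eq_bigr => k _; congr (_ / _).
  have [|wa a1 a2 _] := @arrivalP _ s0 T k w; first by rewrite nT.
  rewrite !indicE !mem_set// => Da; have : (points w `&` D) (arrival s0 k w) by [].
  by rewrite vw.
rewrite indicE memNset// mul0r.
have /set0P[s [ws Ds]] : points w `&` D != set0 by apply/eqP.
have := DT _ Ds; rewrite /= in_itv/= => /andP[s0s sT].
have kn : (nbefore s0 s w < n)%N by rewrite -nT lt_nbefore.
rewrite /inv_arrivals (bigD1 (Ordinal kn))//= arrival_uniq//.
by rewrite indicE memNset ?mul0r//= => /(_ Ds).
Qed.

Lemma void_events_setI (R : realType) (s0 T : R) :
  setI_closed (@void_events R s0 T).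
Proof.
move=> _ _ [D [mD DT] <-] [E [mE ET] <-]; exists (D `|` E).
  by split; [exact: measurableU|rewrite subUset].
rewrite /void; apply/seteqP; split=> w /=; rewrite setIUr setU_eq0.
  by move=> [-> ->].
by move=> [-> ->].
Qed.

Section void_generate.
Context {R : realType} (s0 T : R).

Notation voidT := (g_sigma_algebraType (@void_events R s0 T)).

(** Since points have multiplicity one, the event that [D] contains more than
    [k] points before [q] is a countable combination of void events. *)
Lemma void_nbefore_gt (D : set R) (k : nat) (q : R) : measurable D -> q <= T ->
  measurable ([set w | (k < nbefore s0 q (restrict_config D w))%N] : set voidT).
Proof.
move=> mD; elim: k q => [|k IH] q qT.
  rewrite (_ : [set w | _] = ~` void (D `&` `]s0, q[)).
    apply: measurableC; apply: sub_sigma_algebra; exists (D `&` `]s0, q[) => //.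
    split; first exact: measurableI.
    by move=> x [_]; rewrite /= !in_itv/= => /andP[-> /lt_le_trans->].
  apply/seteqP; split=> w /=; rewrite /void /nbefore /= -setIA.
    by move=> n0 v; move: n0; rewrite v fset_set0.
  move=> nv; rewrite lt0n cardfs_eq0; apply/negP => /eqP/fset_set_set0 E.
  apply: nv; apply: E; rewrite setIA.
  exact: (finite_before s0 q (restrict_config D w)).
pose E (r : R) := D `&` `]s0, q[ `&` `[r, q[.
rewrite (_ : [set w | _] = \bigcup_(r : rat) [set w | ratr r < q /\
   ((k < nbefore s0 (ratr r) (restrict_config D w))%N /\
    (~` void (E (ratr r))) w)]).
  apply: bigcupT_measurable_rat => r.
  have [rq|rq] := ltP (ratr r) q; last first.
    by rewrite (_ : [set w | _] = set0)//; apply/seteqP; split => // w [].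
  rewrite (_ : [set w | _] =
     [set w | (k < nbefore s0 (ratr r) (restrict_config D w))%N] `&` ~` void (E (ratr r))).
    apply: measurableI; first by apply: IH; rewrite ltW// (lt_le_trans rq).
    apply: measurableC; apply: sub_sigma_algebra; exists (E (ratr r)) => //.
    split; first by apply: measurableI => //; exact: measurableI.
    by move=> x [[_ + _]]; rewrite /= !in_itv/= => /andP[-> /lt_le_trans->].
  by apply/seteqP; split => [w [_ []]|w []].
apply/seteqP; split=> w /=.
  move=> k1; have [wa a1 a2 na] := arrivalP k1.
  have [_ b1 b2 nb] := arrivalP (ltnW k1).
  have ba : arrival s0 k (restrict_config D w) < arrival s0 k.+1 (restrict_config D w).
    by rewrite -(lt_nbefore_arrival _ (ltnW k1)) na.
  have [r] := rat_in_itvoo ba; rewrite in_itv/= => /andP[br ra].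
  exists r => //=; split; first exact: lt_trans ra a2.
  split; first by rewrite (lt_nbefore_arrival _ (ltnW k1)).
  move: wa => /= [wa Da]; rewrite /void => v.
  suff : (points w `&` E (ratr r)) (arrival s0 k.+1 (restrict_config D w)) by rewrite v.
  by split => //; split; [split => //|]; rewrite /= in_itv/= ?a1 ?a2 ?(ltW ra).
move=> [r _ /= [rq [kr]]] /eqP/set0P[x [wx [[Dx]]]].
rewrite /= !in_itv/= => /andP[s0x xq] /andP[rx _].
have wDx : points (restrict_config D w) x by [].
apply: (leq_ltn_trans _ (lt_nbefore wDx s0x xq)).
exact: (leq_trans kr (le_nbefore _ _ rx)).
Qed.

(** Weights up to time [T] and estimators only see these points. *)
Definition record (w : config R) : config R := restrict_config `]s0, T[ w.

Lemma npoints_record (D : set R) (w : config R) :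
  npoints D (record w) = (nbefore s0 T (restrict_config D w))%:R%:E.
Proof.
rewrite -npoints_before /npoints /=; congr counting.
by rewrite -!setIA; congr (_ `&` _); rewrite setIC.
Qed.

Lemma void_generate (A : set (config R)) :
  measurable A -> <<s void_events s0 T >> (record @^-1` A).
Proof.
suff mrec : measurable_fun [set: voidT] (record : voidT -> config R).
  by move=> mA; have := mrec measurableT _ mA; rewrite setTI.
apply: (@measurability _ _ voidT (config R) setT record (count_events setT)) => //.
move=> _ [_ [D [mD _]] [C mC <-] <-]; rewrite !setTI.
pose N k : set voidT := [set w | (k <= nbefore s0 T (restrict_config D w))%N].
have mN k : measurable (N k).
  case: k => [|k]; last exact: void_nbefore_gt.
  by rewrite (_ : N 0%N = setT)//; apply/seteqP; split.
rewrite (_ : _ @^-1` _ = \bigcup_(k in [set k : nat | C k%:R%:E]) (N k `\` N k.+1)).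
  by apply: bigcup_measurable => k _; apply: measurableD.
apply/seteqP; split=> w /=; rewrite npoints_record.
  by move=> Cn; exists (nbefore s0 T (restrict_config D w)); rewrite /N //= ltnn; split.
move=> [k /= Ck []]; rewrite /N /= => k1 /negP; rewrite -leqNgt => k2.
by rewrite (_ : nbefore _ _ _ = k)//; apply/eqP; rewrite eqn_leq k1 k2.
Qed.

End void_generate.

Lemma record_measurable (R : realType) (s0 T : R) (A : set (config R)) :
  measurable A -> measurable (@record R s0 T @^-1` A).
Proof.
move=> /(@void_generate R s0 T); apply: smallest_sub.
  exact: sigma_algebra_measurable.
by move=> _ [D [mD DT] <-]; exact: measurable_void DT.
Qed.

Section weighted_law.
Context {R : realType} (P P' : probability (config R) R) (s0 mu T : R).
Context (l l' : R * config R -> R) (n : nat).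
Hypothesis hP : bounded_intensity P s0 mu l.
Hypothesis hP' : bounded_intensity P' s0 mu l'.
Hypothesis s0T : s0 <= T.

Let L w := weight s0 l setT n (T, w).
Let L' w := weight s0 l' setT n (T, w).

Lemma bounded_intensity_gt0 Q m : bounded_intensity Q s0 mu m -> forall x, 0 < m x.
Proof. by move=> [mu0 mu_le _ _ _ _] x; exact: lt_le_trans (mu_le x). Qed.

Lemma measurable_weight Q m B k : measurable B -> bounded_intensity Q s0 mu m ->
  measurable_fun setT (fun w => weight s0 m B k (T, w)).
Proof.
move=> mB hQ; have m0 := bounded_intensity_gt0 hQ.
exact: (measurable_fun_pair2 T (predictable_measurable
  (predictable_weight mB m0 (bi_predictable hQ) k))).
Qed.

Lemma mean_weight_fin Q m B k : measurable B -> bounded_intensity Q s0 mu m ->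
  mean_weight Q s0 m B k T \is a fin_num.
Proof.
move=> mB hQ; rewrite ge0_fin_numE; last first.
  by apply: integral_ge0 => w _; rewrite lee_fin (weight_ge0 s0 _ (bi_gt0 hQ) (bi_ge hQ)).
apply: (@le_lt_trans _ _ (\int[Q]_w (cst (weight_bound s0 mu k T)%:E w))%E).
  apply: ge0_le_integral => //.
  - by move=> w _; rewrite lee_fin (weight_ge0 s0 _ (bi_gt0 hQ) (bi_ge hQ)).
  - by apply/measurable_EFinP; exact: measurable_weight hQ.
  - move=> w _; rewrite lee_fin.
    exact: (weight_le B (bi_gt0 hQ) (bi_ge hQ) (bi_integral hQ)).
rewrite integral_cst// [X in (_ * X)%E](_ : _ = 1%E); last exact: probability_setT.
by rewrite mule1 ltry.
Qed.

(** Void events are stable under intersection and the weighted laws agree on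
    them, since these masses are mean weights. *)
Lemma weighted_law_void (E : set (config R)) : <<s void_events s0 T >> E ->
  (\int[P]_w (\1_E w * L w)%:E = \int[P']_w (\1_E w * L' w)%:E)%E.
Proof.
have mL Q m : bounded_intensity Q s0 mu m ->
    measurable_fun setT (fun w => (weight s0 m setT n (T, w))%:E).
  by move=> hQ; apply/measurable_EFinP; exact: measurable_weight hQ.
have L0 Q m w : bounded_intensity Q s0 mu m -> (0 <= (weight s0 m setT n (T, w))%:E)%E.
  by move=> hQ; rewrite lee_fin (weight_ge0 s0 _ (bi_gt0 hQ) (bi_ge hQ)).
have mvoid (S : set (config R)) : <<s void_events s0 T >> S -> measurable S.
  apply: smallest_sub; first exact: sigma_algebra_measurable.
  by move=> _ [D [mD DT] <-]; exact: measurable_void DT.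
have restrictE Q m S : bounded_intensity Q s0 mu m -> measurable S ->
    (\int[Q]_w (\1_S w * weight s0 m setT n (T, w))%:E =
     \int[Q]_(w in S) (weight s0 m setT n (T, w))%:E)%E.
  move=> hQ mS; rewrite [RHS]integral_mkcond; apply: eq_integral => w _.
  by rewrite patchE indicE; case: (_ \in _); rewrite ?mul1r ?mul0r.
have fin Q m S : bounded_intensity Q s0 mu m -> measurable S ->
    (\int[Q]_(w in S) (weight s0 m setT n (T, w))%:E)%E \is a fin_num.
  move=> hQ mS; rewrite ge0_fin_numE; last by apply: integral_ge0 => w _; exact: L0 hQ.
  apply: (@le_lt_trans _ _ (mean_weight Q s0 m setT n T)).
    apply: ge0_subset_integral => //; first exact: mL hQ.
    by move=> w _; exact: L0 hQ.
  by have := mean_weight_fin n measurableT hQ; rewrite ge0_fin_numE//;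
    apply: integral_ge0 => w _; exact: L0 hQ.
move=> /[dup] sE /mvoid mE; rewrite (restrictE P)// (restrictE P')//.
move: E sE mE; suff H E : <<s void_events s0 T >> E ->
   (\int[P]_(w in E) (L w)%:E = \int[P']_(w in E) (L' w)%:E)%E.
  by move=> E sE _; exact: H.
have total : (\int[P]_w (L w)%:E = \int[P']_w (L' w)%:E)%E.
  exact: (mean_weight_eq measurableT hP hP' n s0T).
move: E; apply: (@dynkin_induction _ (g_sigma_algebraType (void_events s0 T))
  (void_events s0 T) (fun E => (\int[P]_(w in E) (L w)%:E = \int[P']_(w in E) (L' w)%:E)%E)
  erefl (@void_events_setI R s0 T)) => //.
- move=> _ [D [mD DT] <-].
  rewrite -(restrictE P)//; last exact: measurable_void DT.
  rewrite -(restrictE P')//; last exact: measurable_void DT.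
  under eq_integral do rewrite -weight_void//.
  under [RHS]eq_integral do rewrite -weight_void//.
  exact: (mean_weight_eq (measurableC mD) hP hP').
- move=> S /mvoid mS IH.
  have split Q m : bounded_intensity Q s0 mu m ->
      (\int[Q]_w (weight s0 m setT n (T, w))%:E =
       \int[Q]_(w in S) (weight s0 m setT n (T, w))%:E +
       \int[Q]_(w in ~` S) (weight s0 m setT n (T, w))%:E)%E.
    move=> hQ; rewrite -ge0_integral_setU//; last 4 first.
    - exact: measurableC.
    - by rewrite setUCr; exact: mL hQ.
    - by move=> w _; exact: L0 hQ.
    - by rewrite disj_set2E setICr.
    by rewrite setUCr.
  move: total; rewrite (split _ _ hP) (split _ _ hP') -/L -/L' IH.
  move=> /(congr1 (fun z => z - \int[P']_(w in S) (L' w)%:E)%E).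
  by rewrite ![(\int[P']_(w in S) (L' w)%:E + _)%E]addeC !addeK// (fin _ _ _ hP').
- move=> F mF tF IH; have mF' k := mvoid _ (mF k).
  rewrite !ge0_integral_bigcup//.
  + by apply: eq_eseriesr => k _; exact: IH.
  + by apply: measurable_funTS; exact: mL hP'.
  + by move=> w _; exact: L0 hP'.
  + by apply: measurable_funTS; exact: mL hP.
  + by move=> w _; exact: L0 hP.
Qed.

End weighted_law.

Import HBNNSimple.

(** Equality on indicators extends to nonnegative functions through simple
    functions and monotone convergence. *)
Lemma integral_weighted_eq d d' (T : measurableType d) (X : measurableType d')
    (R : realType) (m1 m2 : {measure set T -> \bar R}) (phi : T -> X)
    (f1 f2 : T -> R) :
  measurable_fun setT phi ->
  (forall w, 0 <= f1 w) -> measurable_fun setT f1 ->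
  (forall w, 0 <= f2 w) -> measurable_fun setT f2 ->
  (forall A, measurable A ->
    \int[m1]_w (\1_(phi @^-1` A) w * f1 w)%:E =
    \int[m2]_w (\1_(phi @^-1` A) w * f2 w)%:E)%E ->
  forall h : X -> \bar R, (forall x, 0 <= h x)%E -> measurable_fun setT h ->
  (\int[m1]_w (h (phi w) * (f1 w)%:E) = \int[m2]_w (h (phi w) * (f2 w)%:E))%E.
Proof.
move=> mphi f10 mf1 f20 mf2 f12 h h0 mh.
pose g := nnsfun_approx measurableT mh.
have mgphi n : measurable_fun setT (fun w => g n (phi w)).
  by apply: measurableT_comp.
have simple (m : {measure set T -> \bar R}) (f : T -> R) n :
    (forall w, 0 <= f w) -> measurable_fun setT f ->
    (\int[m]_w (g n (phi w) * f w)%:E =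
     \sum_(y \in range (g n)) y%:E *
       \int[m]_w (\1_(phi @^-1` (g n @^-1` [set y])) w * f w)%:E)%E.
  move=> f0 mf.
  have mpre y : measurable (phi @^-1` (g n @^-1` [set y])).
    by rewrite -[X in measurable X]setTI; apply: mphi.
  have mt y : measurable_fun setT (fun w => (\1_(phi @^-1` (g n @^-1` [set y])) w * f w)%:E).
    by apply/measurable_EFinP; apply: measurable_funM => //; exact: measurable_indic.
  have t0 y w : 0 <= y * (\1_(phi @^-1` (g n @^-1` [set y])) w * f w).
    rewrite indicE; case: (boolP (w \in _)) => [/set_mem/= <-|_].
      by rewrite !mulr_ge0.
    by rewrite mul0r mulr0.
  transitivity (\int[m]_w (\sum_(y \in range (g n))
      (y * (\1_(phi @^-1` (g n @^-1` [set y])) w * f w))%:E))%E.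
    apply: eq_integral => w _; rewrite fsbig_finite//= sumEFin; congr EFin.
    rewrite fimfunE fsbig_finite//= mulr_suml.
    by apply: eq_bigr => y _; rewrite mulrA.
  rewrite ge0_integral_fsum//; last 2 first.
  - by move=> y; under eq_fun do rewrite EFinM; exact: measurable_funeM.
  - by move=> y w _; rewrite lee_fin.
  apply: eq_fsbigr => y /set_mem[x _ <-].
  under eq_integral do rewrite EFinM.
  by rewrite ge0_integralZl_EFin// => w _; rewrite lee_fin mulr_ge0.
have approach (m : {measure set T -> \bar R}) (f : T -> R) :
    (forall w, 0 <= f w) -> measurable_fun setT f ->
    (\int[m]_w (h (phi w) * (f w)%:E) =
     limn (fun n => \int[m]_w (g n (phi w) * f w)%:E))%E.
  move=> f0 mf; rewrite -monotone_convergence//; last 3 first.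
  - by move=> n; apply/measurable_EFinP; exact: measurable_funM.
  - by move=> n w _; rewrite lee_fin mulr_ge0.
  - move=> w _ a b ab; rewrite lee_fin ler_wpM2r//.
    exact/lefP/nd_nnsfun_approx.
  apply: eq_integral => w _; apply/esym/cvg_lim => //.
  under eq_fun do rewrite EFinM.
  apply: cvgeZr => //; apply: cvg_nnsfun_approx => //.
rewrite (approach m1)// (approach m2)//; congr (limn _); apply/funext => n.
rewrite simple// simple//; apply: eq_fsbigr => y _; congr (_ * _)%E.
by apply: f12; rewrite -[X in measurable X]setTI; exact: measurable_funP.
Qed.

Section invariance.
Context {R : realType} (P : probability (config R) R) (s0 mu T : R).
Context (l : R * config R -> R).
Hypothesis hP : bounded_intensity P s0 mu l.

Lemma record_before (t : R) (w : config R) : t <= T ->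
  points (record s0 T w) `&` `]s0, t[ = points w `&` `]s0, t[.
Proof.
move=> tT; rewrite /record /= -setIA; congr (_ `&` _).
apply/seteqP; split=> x /=; first by move=> [].
move=> xt; split => //; move: xt.
by rewrite !in_itv/= => /andP[-> /lt_le_trans ->].
Qed.

Lemma nbefore_record (t : R) (w : config R) : t <= T ->
  nbefore s0 t (record s0 T w) = nbefore s0 t w.
Proof. by move=> tT; rewrite /nbefore record_before. Qed.

Lemma arrival_record (k : nat) (w : config R) : (k < nbefore s0 T w)%N ->
  arrival s0 k (record s0 T w) = arrival s0 k w.
Proof.
move=> /arrivalP[wa a1 a2 na].
rewrite -[k in LHS]na -(nbefore_record w (ltW a2)) arrival_uniq//.
by split => //=; rewrite in_itv/= a1.
Qed.

Lemma weight_record (B : set R) (n : nat) (w : config R) :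
  weight s0 l B n (T, record s0 T w) = weight s0 l B n (T, w).
Proof.
rewrite /weight /= nbefore_record//; case: eqP => // nT; congr (expR _ * _).
  congr fine; apply: eq_integral => s /set_mem; rewrite /= in_itv/= => /andP[_ sT].
  by rewrite (bi_local hP (record_before w (ltW sT))).
apply: eq_bigr => k _.
have kT : (k < nbefore s0 T w)%N by rewrite nT.
rewrite arrival_record//; have [_ _ a2 _] := arrivalP kT.
by rewrite (bi_local hP (record_before w (ltW a2))).
Qed.

End invariance.

Section likelihood.
Context {R : realType} (P P' : probability (config R) R) (s0 mu T : R).
Context (l l' : R * config R -> R).
Hypothesis hP : bounded_intensity P s0 mu l.
Hypothesis hP' : bounded_intensity P' s0 mu l'.
Hypothesis s0T : s0 <= T.

Let l0 := bounded_intensity_gt0 hP.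
Let l0' := bounded_intensity_gt0 hP'.

(** The weighted laws of [P] and [P'] are the same measure; dividing it by the
    weight of [l'] recovers [P']. *)
Lemma change_of_law (n : nat) (A : set (config R)) : measurable A ->
  (\int[P]_w (\1_A (record s0 T w) *
      (weight s0 l setT n (T, w) / weight s0 l' setT n (T, w)))%:E =
   P' (record s0 T @^-1` A `&` [set w | nbefore s0 T w = n]))%E.
Proof.
move=> mA; pose L w := weight s0 l setT n (T, w).
pose L' w := weight s0 l' setT n (T, w).
have L0 w : 0 <= L w by exact: weight_ge0 (bi_gt0 hP) (bi_ge hP) _ _.
have L0' w : 0 <= L' w by exact: weight_ge0 (bi_gt0 hP') (bi_ge hP') _ _.
have mL : measurable_fun setT L by exact: measurable_weight hP.
have mL' : measurable_fun setT L' by exact: measurable_weight hP'.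
have mrec : measurable_fun setT (@record R s0 T).
  by move=> _ C mC; rewrite setTI; exact: record_measurable.
(* off the event of [n] points both weights vanish, and so does this quotient,
   the inverse of 0 being 0 *)
pose h w := (\1_A w * (L' w)^-1)%:E.
have h0 w : (0 <= h w)%E by rewrite lee_fin mulr_ge0// invr_ge0.
have mh : measurable_fun setT h.
  apply/measurable_EFinP; apply: measurable_funM; first exact: measurable_indic.
  exact: measurable_inv_ge0.
have sets B : measurable B ->
    (\int[P]_w (\1_(record s0 T @^-1` B) w * L w)%:E =
     \int[P']_w (\1_(record s0 T @^-1` B) w * L' w)%:E)%E.
  by move=> mB; apply: (weighted_law_void n hP hP' s0T); exact: void_generate.
transitivity (\int[P]_w (h (record s0 T w) * (L w)%:E))%E.
  apply: eq_integral => w _; rewrite /h /L' (weight_record T hP') -EFinM; congr EFin.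
  by rewrite -mulrA; congr (_ * _); rewrite mulrC.
rewrite (integral_weighted_eq mrec L0 mL L0' mL' sets h0 mh).
pose E := record s0 T @^-1` A `&` [set w | nbefore s0 T w = n].
have mE : measurable E.
  by apply: measurableI; [exact: record_measurable|exact: measurable_count].
rewrite -/E -[E]setIT -integral_indic//; apply: eq_integral => w _.
rewrite /h /L' (weight_record T hP') -EFinM; congr EFin; rewrite -mulrA.
rewrite /weight /=; case: eqP => nT; last first.
  by rewrite mulr0 mulr0 indicE memNset// => -[].
rewrite mulVf ?mulr1.
  rewrite !indicE (_ : (_ \in A) = (w \in E))//.
  by apply/idP/idP => /set_mem h1; apply/mem_set => //; case: h1.
rewrite mulf_neq0// ?gt_eqF ?expR_gt0//; apply: prodr_gt0 => k _.
by rewrite indicE mem_set// divr_gt0.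
Qed.

Let C x := (l x - l' x) / l' x.
Let Y w : \bar R := pp_integral `]s0, T[ (fun s => (C (s, w))%:E) w.

Hypothesis l'_le : forall x, l' x <= l x.

Let C0 x : 0 <= C x.
Proof. by rewrite divr_ge0 ?subr_ge0// ltW. Qed.

Lemma pp_integral_arrivals (w : config R) (h : R -> R) : (forall s, 0 <= h s) ->
  pp_integral `]s0, T[ (fun s => (h s)%:E) w =
  (\sum_(k < nbefore s0 T w) h (arrival s0 k w))%:E.
Proof.
move=> h0; set n := nbefore s0 T w.
transitivity (\esum_(s in points w `&` `]s0, T[)
    (\sum_(k < n) (if nbefore s0 s w == k then (h s)%:E else 0%E))).
  apply: eq_esum => s [ws]; rewrite /= in_itv/= => /andP[s0s sT].
  have sn : (nbefore s0 s w < n)%N by exact: lt_nbefore.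
  rewrite (bigD1 (Ordinal sn))//= eqxx big1 ?adde0// => k.
  by rewrite -val_eqE /= eq_sym => /negbTE ->.
rewrite esum_sum; last by move=> s k _ _; case: ifP; rewrite ?lee_fin.
rewrite -sumEFin; apply: eq_bigr => k _.
have := @pp_integral_label _ s0 T k (fun s => (h s)%:E) w.
by rewrite ltn_ord; apply=> s; rewrite lee_fin.
Qed.

(** The ratio of the weights exceeds the exponential of minus the compensated
    sum of [C], by [1 + c <= expR c] at each point. *)
Lemma weight_ratio_ge (n : nat) (w : config R) : nbefore s0 T w = n ->
  expR (cumul s0 l T w - cumul s0 l' T w - fine (Y w)) <=
  weight s0 l setT n (T, w) / weight s0 l' setT n (T, w).
Proof.
move=> nT; rewrite /Y pp_integral_arrivals// nT /weight /= nT eqxx.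
have -> : expR (cumul s0 l T w) * inv_arrivals s0 l setT n w /
    (expR (cumul s0 l' T w) * inv_arrivals s0 l' setT n w) =
    expR (cumul s0 l T w - cumul s0 l' T w) *
    (inv_arrivals s0 l setT n w / inv_arrivals s0 l' setT n w).
  by rewrite invfM mulrACA expRD expRN.
rewrite expRD ler_pM2l ?expR_gt0// /inv_arrivals -prodf_div expRN.
rewrite expR_sum -prodfV; apply: ler_prod => k _.
rewrite invr_ge0 expR_ge0 /=.
rewrite !indicE !mem_set// !mul1r invrK mulrC.
rewrite -[leRHS]invrK lef_pV2 ?posrE ?expR_gt0//; last by rewrite invr_gt0 divr_gt0.
rewrite invf_div; apply: le_trans (expR_ge1Dx _).
by rewrite /C mulrBl divff ?gt_eqF// addrC subrK.
Qed.

End likelihood.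

(** * Two-point bound *)

Lemma measurable_cumul (R : realType) (s0 T : R) (l : R * config R -> R) :
  (forall x, 0 <= l x) -> measurable_fun setT (l : past R s0 -> R) ->
  measurable_fun setT (fun w => cumul s0 l T w).
Proof.
move=> l0 ml; apply: (measurableT_comp (fine_measurable measurableT)).
have le0 x : (0 <= (l x)%:E)%E by rewrite lee_fin.
have mle : measurable_fun setT ((fun x => (l x)%:E) : past R s0 -> \bar R).
  by apply/measurable_EFinP.
exact: (measurable_fun_pair2 T (predictable_measurable (predictable_integral le0 mle))).
Qed.

Lemma bigcup_count (R : realType) (s0 T : R) :
  \bigcup_n [set w : config R | nbefore s0 T w = n] = setT.
Proof. by apply/seteqP; split=> // w _; exists (nbefore s0 T w). Qed.

Lemma measurable_pp_integral (R : realType) (s0 T : R) (h : R * config R -> R) :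
  (forall x, 0 <= h x) -> measurable_fun setT (h : past R s0 -> R) ->
  measurable_fun setT (fun w => pp_integral `]s0, T[ (fun s => (h (s, w))%:E) w).
Proof.
move=> h0 mh; rewrite -(bigcup_count s0 T).
apply/measurable_fun_bigcup => [n|n]; first exact: measurable_count.
apply: (eq_measurable_fun (fun w => \sum_(k < n)
  (if (k < nbefore s0 T w)%N then (h (arrival s0 k w, w))%:E else 0))%E).
  move=> w /set_mem/= nT; rewrite (@pp_integral_arrivals _ s0 T w (fun s => h (s, w)))// -sumEFin nT.
  by apply: eq_bigr => k _; rewrite ltn_ord.
apply: measurable_funTS; apply: emeasurable_sum => k.
apply: (@predictable_at_arrival R s0 T k (fun x => (h x)%:E)).
by apply/measurable_EFinP; exact: measurable_funTS.
Qed.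

Section two_points.
Context {R : realType} (P P' : probability (config R) R) (s0 mu T : R).
Context (l l' : R * config R -> R).
Hypothesis hP : bounded_intensity P s0 mu l.
Hypothesis hP' : bounded_intensity P' s0 mu l'.
Hypothesis s0T : s0 <= T.
Hypothesis l'_le : forall x, l' x <= l x.

Let l0 := bounded_intensity_gt0 hP.
Let l0' := bounded_intensity_gt0 hP'.
Let C x := (l x - l' x) / l' x.
Let C0 x : 0 <= C x.
Proof. by rewrite divr_ge0 ?subr_ge0// ltW. Qed.

Let mC : measurable_fun setT (C : past R s0 -> R).
Proof.
have ml := bi_predictable hP; have ml' := bi_predictable hP'.
apply: measurable_funM; first exact: measurable_funB.
by apply: measurable_inv_ge0 => // x; exact: ltW.
Qed.

(** An upper bound of the logarithm of the likelihood ratio of [P] to [P'],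
    obtained from [ln x <= x - 1] at each point. *)
Definition log_ratio (w : config R) : R :=
  fine (pp_integral `]s0, T[ (fun s => ((l (s, w) - l' (s, w)) / l' (s, w))%:E) w)
  - (cumul s0 l T w - cumul s0 l' T w).

Lemma measurable_log_ratio : measurable_fun setT log_ratio.
Proof.
apply: measurable_funB.
  apply: (measurableT_comp (fine_measurable measurableT)).
  exact: (measurable_pp_integral T C0 mC).
apply: measurable_funB.
  exact: (measurable_cumul T (fun x => ltW (l0 x)) (bi_predictable hP)).
exact: (measurable_cumul T (fun x => ltW (l0' x)) (bi_predictable hP')).
Qed.

(** The bound of [weight_ratio_ge] holds on each set of configurations with a
    given number of points; these sets partition the space. *)
Lemma likelihood_ratio_ge (A : set (config R)) : measurable A ->
  (\int[P]_w (\1_A (record s0 T w) * expR (- log_ratio w))%:E <=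
   P' (record s0 T @^-1` A))%E.
Proof.
move=> mA.
pose N n : set (config R) := [set w | nbefore s0 T w = n].
have mN n : measurable (N n) by exact: measurable_count.
have tN : trivIset setT N by move=> i j _ _ [w [/= <- <-]].
have mrec : measurable_fun setT (@record R s0 T).
  by move=> _ D mD; rewrite setTI; exact: record_measurable.
have mf : measurable_fun setT (fun w => (\1_A (record s0 T w) * expR (- log_ratio w))%:E).
  apply/measurable_EFinP; apply: measurable_funM.
    by apply: (measurableT_comp (@measurable_indic _ _ R setT _ mA)).
  apply: (measurableT_comp (@measurable_expR R)); apply: measurable_funN.
  exact: measurable_log_ratio.
have f0 w : (0 <= (\1_A (record s0 T w) * expR (- log_ratio w))%:E)%E.
  by rewrite lee_fin mulr_ge0// expR_ge0.
have NT : \bigcup_n N n = setT by exact: bigcup_count.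
rewrite -[X in (\int[P]_(w in X) _ <= _)%E]NT ge0_integral_bigcup//; last by rewrite NT.
rewrite -[X in (_ <= P' X)%E]setIT -NT setI_bigcupr measure_semi_bigcup//; last 3 first.
- by move=> n; apply: measurableI => //; exact: record_measurable.
- by apply: trivIset_setIl.
- by apply: bigcup_measurable => n _; apply: measurableI => //; exact: record_measurable.
apply: lee_nneseries => [n _ _|n _]; first by apply: integral_ge0 => w _; exact: f0.
rewrite integral_mkcond.
pose g w := (\1_A (record s0 T w) *
  (weight s0 l setT n (T, w) / weight s0 l' setT n (T, w)))%:E.
have g0 w : (0 <= g w)%E.
  rewrite lee_fin !mulr_ge0// ?invr_ge0.
    exact: weight_ge0 (bi_gt0 hP) (bi_ge hP) _ _.
  exact: weight_ge0 (bi_gt0 hP') (bi_ge hP') _ _.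
have := change_of_law hP hP' s0T n mA; rewrite -/g => lawE.
apply: (@le_trans _ _ (\int[P]_w g w)%E); last by rewrite /g lawE.
apply: ge0_le_integral => //.
- by move=> w _; rewrite patchE; case: ifP.
- by apply/(measurable_restrictT _ (mN n)); exact: measurable_funTS.
- apply/measurable_EFinP; apply: measurable_funM.
    by apply: (measurableT_comp (@measurable_indic _ _ R setT _ mA)).
  apply: measurable_funM; first exact: measurable_weight hP.
  apply: measurable_inv_ge0; last exact: measurable_weight hP'.
  by move=> w; exact: weight_ge0 (bi_gt0 hP') (bi_ge hP') _ _.
move=> w _; rewrite patchE; case: ifPn => [/set_mem nT|_]; last exact: g0.
rewrite lee_fin ler_wpM2l//.
have := weight_ratio_ge hP hP' l'_le nT.
by rewrite /log_ratio opprB.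
Qed.

(** By [likelihood_ratio_ge], [expR (- log_ratio)] has mean at most one, so the
    negative part of [log_ratio] does too; the mean of [log_ratio] is the
    integral bounded by [K]. Its positive part hence has mean at most [K + 1],
    and by Markov's inequality [log_ratio] is at most [2 * (K + 1)] with
    probability at least one half. There the likelihood ratio of [P'] to [P] is
    at least [expR (- (2 * (K + 1)))]. *)
Lemma two_point_bound (K : R) (A : set (config R)) : 0 <= K -> measurable A ->
  (\int[P]_w (cumul s0 l T w)%:E < +oo)%E ->
  (\int[P]_w \int[lebesgue_measure]_(s in `]s0, T[)
     ((l (s, w) - l' (s, w)) ^+ 2 / l' (s, w))%:E <= K%:E)%E ->
  ((expR (- (2 * (K + 1))) / 2)%:E <=
   P (record s0 T @^-1` A) + P' (record s0 T @^-1` (~` A)))%E.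
Proof.
move=> K0 mA fin_mean entropy.
pose Y w := pp_integral `]s0, T[ (fun s => (C (s, w))%:E) w.
pose Z w := cumul s0 l T w - cumul s0 l' T w.
pose X := log_ratio.
have ml := bi_predictable hP; have ml' := bi_predictable hP'.
have mpath (h : R * config R -> R) w : measurable_fun setT (h : past R s0 -> R) ->
    measurable_fun setT (fun s => (h (s, w))%:E).
  move=> mh; apply/measurable_EFinP.
  exact: (measurable_fun_pair1 w (predictable_measurable mh)).
have cumE (Q : probability (config R) R) m w : bounded_intensity Q s0 mu m ->
    (\int[lebesgue_measure]_(s in `]s0, T[) (m (s, w))%:E = (cumul s0 m T w)%:E)%E.
  move=> hQ; have m0 := bounded_intensity_gt0 hQ.
  rewrite /cumul fineK// ge0_fin_numE; last first.
    by apply: integral_ge0 => s _; rewrite lee_fin ltW.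
  by apply: le_lt_trans (bi_integral hQ w s0T) _; rewrite ltry.
have diffE w : (\int[lebesgue_measure]_(s in `]s0, T[) (l (s, w) - l' (s, w))%:E =
    (Z w)%:E)%E.
  have : ((cumul s0 l T w)%:E = \int[lebesgue_measure]_(s in `]s0, T[)
     (l (s, w) - l' (s, w))%:E + (cumul s0 l' T w)%:E)%E.
    rewrite -(cumE _ _ _ hP) -(cumE _ _ _ hP') -ge0_integralD//.
    - by apply: eq_integral => s _; rewrite -EFinD subrK.
    - by move=> s _; rewrite lee_fin subr_ge0.
    - apply: measurable_funTS; apply: (mpath (fun x => l x - l' x)).
      exact: measurable_funB.
    - by move=> s _; rewrite lee_fin ltW.
    - by apply: measurable_funTS; apply: (mpath l').
  rewrite /Z; case: (integral _ _ _) => [r| |]//= [->].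
  by rewrite addrK.
have Z0 w : 0 <= Z w.
  by rewrite -lee_fin -diffE; apply: integral_ge0 => s _; rewrite lee_fin subr_ge0.
have mY : measurable_fun setT Y by exact: measurable_pp_integral.
have Y0 w : (0 <= Y w)%E by apply: esum_ge0 => s _; rewrite lee_fin.
have Yfin w : Y w = (fine (Y w))%:E.
  by rewrite /Y (@pp_integral_arrivals _ s0 T w (fun s => C (s, w))).
have mcum (Q : probability (config R) R) m : bounded_intensity Q s0 mu m ->
    measurable_fun setT (fun w => cumul s0 m T w).
  by move=> hQ; apply: (measurable_cumul T (fun x => ltW (bounded_intensity_gt0 hQ x)));
    exact: bi_predictable hQ.
have mZ : measurable_fun setT Z by apply: measurable_funB; [exact: mcum hP|exact: mcum hP'].
have mX : measurable_fun setT X by exact: measurable_log_ratio.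
have EZ_fin : (\int[P]_w (Z w)%:E \is a fin_num)%E.
  rewrite ge0_fin_numE; last by apply: integral_ge0 => w _; rewrite lee_fin.
  apply: le_lt_trans fin_mean; apply: ge0_le_integral => //.
  - by move=> w _; rewrite lee_fin.
  - exact/measurable_EFinP.
  - by apply/measurable_EFinP; exact: mcum hP.
  - move=> w _; rewrite lee_fin /Z gerBl -lee_fin -(cumE _ _ _ hP').
    by apply: integral_ge0 => s _; rewrite lee_fin ltW.
have EY : (\int[P]_w Y w <= K%:E + \int[P]_w (Z w)%:E)%E.
  rewrite (local_intensity (lam := EFin \o l) (bi_intensity hP) (T := T)
    (C := EFin \o C)); last 2 first.
  - by move=> x; rewrite lee_fin.
  - by apply/measurable_EFinP; exact: measurable_funTS.
  have mD : measurable_fun setT ((fun x => (l x - l' x) ^+ 2 / l' x) : past R s0 -> R).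
    apply: measurable_funM; first by apply: measurable_funX; exact: measurable_funB.
    by apply: measurable_inv_ge0 => // x; exact: ltW.
  have D0 x : (0 <= ((l x - l' x) ^+ 2 / l' x)%:E)%E.
    by rewrite lee_fin divr_ge0 ?sqr_ge0// ltW.
  rewrite [leLHS](_ : _ = \int[P]_w (\int[lebesgue_measure]_(s in `]s0, T[)
     ((l (s, w) - l' (s, w)) ^+ 2 / l' (s, w))%:E + (Z w)%:E))%E; last first.
    apply: eq_integral => w _; rewrite -diffE -ge0_integralD//.
    - apply: eq_integral => s _; rewrite /= -EFinM -EFinD; congr EFin; rewrite /C.
      have := l0' (s, w); move: (l (s, w)) (l' (s, w)) => a b b0.
      by field; rewrite gt_eqF.
    - by apply: measurable_funTS; exact: mpath mD.
    - by move=> s _; rewrite lee_fin subr_ge0.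
    - apply: measurable_funTS; apply: (mpath (fun x => l x - l' x)).
      exact: measurable_funB.
  rewrite ge0_integralD//.
  - by rewrite leeD2r.
  - by move=> w _; apply: integral_ge0 => s _.
  - have mDe : measurable_fun setT
      ((fun x => ((l x - l' x) ^+ 2 / l' x)%:E) : past R s0 -> \bar R).
      exact/measurable_EFinP.
    exact: (measurable_fun_pair2 T (predictable_measurable (predictable_integral D0 mDe))).
  - by move=> w _; rewrite lee_fin.
  - exact/measurable_EFinP.
have Eexp : (\int[P]_w (expR (- X w))%:E <= 1)%E.
  have := likelihood_ratio_ge measurableT; rewrite preimage_setT.
  rewrite [X in (_ <= X)%E -> _](_ : _ = 1%E); last exact: probability_setT.
  apply: le_trans; rewrite le_eqVlt; apply/orP; left; apply/eqP.
  by apply: eq_integral => w _; rewrite indicE mem_set// mul1r.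
have mexp : measurable_fun setT (fun w => expR (- X w)).
  by apply: (measurableT_comp (@measurable_expR R)); exact: measurable_funN.
have mpos : measurable_fun setT (fun w => Num.max (X w) 0).
  exact: measurable_maxr.
(* [Z] has finite mean and is cancelled at the end; adding it keeps all terms
   nonnegative *)
have Epos : (\int[P]_w (Num.max (X w) 0)%:E <= (K + 1)%:E)%E.
  have : (\int[P]_w (Num.max (X w) 0)%:E + \int[P]_w (Z w)%:E <=
      (K + 1)%:E + \int[P]_w (Z w)%:E)%E.
    rewrite -ge0_integralD//; last 4 first.
    - by move=> w _; rewrite lee_fin le_max lexx orbT.
    - exact/measurable_EFinP.
    - by move=> w _; rewrite lee_fin.
    - exact/measurable_EFinP.
    apply: (@le_trans _ _ (\int[P]_w (Y w + (expR (- X w))%:E))%E).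
      apply: ge0_le_integral => //.
      - by move=> w _; rewrite -EFinD lee_fin addr_ge0// le_max lexx orbT.
      - by apply: emeasurable_funD; exact/measurable_EFinP.
      - by apply: emeasurable_funD => //; exact/measurable_EFinP.
      - move=> w _; rewrite Yfin -!EFinD lee_fin.
        have XE : X w = fine (Y w) - Z w by [].
        have e0 := expR_ge0 (- X w); have e1 := expR_ge1Dx (- X w).
        by rewrite maxEle; case: ifP => _; lra.
    rewrite ge0_integralD//; last exact/measurable_EFinP.
    have addE (z : \bar R) : ((K + 1)%:E + z = K%:E + z + 1)%E.
      by rewrite EFinD -addeA [(1%:E + z)%E]addeC addeA.
    rewrite addE.
    exact: leeD EY Eexp.
  by rewrite leeD2rE.
set kappa := 2 * (K + 1).
have kappa0 : 0 < kappa by rewrite /kappa; lra.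
pose far : set (config R) := [set w | kappa < X w].
have mfar : measurable far.
  rewrite (_ : far = X @^-1` `]kappa, +oo[%classic).
    by rewrite -[X in measurable X]setTI; exact: mX.
  by apply/seteqP; split => w /=; rewrite in_itv/= andbT.
have markov : (P far <= (1 / 2)%:E)%E.
  have : (kappa%:E * P far <= (K + 1)%:E)%E.
    apply: le_trans Epos.
    rewrite -[X in P X]setIT -integral_indic// -ge0_integralZl_EFin//; last 2 first.
    - by apply/measurable_EFinP; exact: measurable_indic.
    - exact: ltW.
    apply: ge0_le_integral => //.
    - by move=> w _; rewrite -EFinM lee_fin mulr_ge0// ltW.
    - apply/measurable_EFinP; apply: measurable_funM => //; exact: measurable_indic.
    - exact/measurable_EFinP.
    - move=> w _; rewrite -EFinM lee_fin indicE.
      case: (boolP (w \in far)) => [/set_mem wf|_]; rewrite ?mulr1 ?mulr0.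
        by rewrite le_max ltW.
      by rewrite le_max lexx orbT.
  have -> : P far = (fine (P far))%:E by rewrite fineK// fin_num_measure.
  by rewrite -EFinM !lee_fin /kappa; nra.
pose A1 := record s0 T @^-1` A; pose A2 := record s0 T @^-1` (~` A).
have mA1 : measurable A1 by exact: record_measurable.
have mA2 : measurable A2 by apply: record_measurable; exact: measurableC.
have mA2f : measurable (A2 `\` far) by exact: measurableD.
have cover : (1 <= P A1 + (P (A2 `\` far) + P far))%E.
  apply: (@le_trans _ _ (P (A1 `|` ((A2 `\` far) `|` far)))).
    rewrite [X in (_ <= P X)%E](_ : _ = setT).
      by rewrite le_eqVlt; apply/orP; left; apply/eqP/esym; exact: probability_setT.
    apply/seteqP; split => // w _; have [wA|wA] := pselect (A1 w); first by left.
    by right; have [wf|wf] := pselect (far w); [right|left].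
  apply: (le_trans (measureU2 P mA1 (measurableU _ _ mA2f mfar))).
  by apply: leeD2l; exact: measureU2.
(* the likelihood ratio is bounded below off [far] *)
have low : ((expR (- kappa))%:E * P (A2 `\` far) <= P' A2)%E.
  apply: le_trans (likelihood_ratio_ge (measurableC mA)).
  rewrite -[X in P X]setIT -integral_indic//.
  rewrite -ge0_integralZl_EFin ?expR_ge0//; last first.
    by apply/measurable_EFinP; apply: measurable_indic; exact: measurableD.
  apply: ge0_le_integral => //.
  - by apply/measurable_EFinP; apply: measurable_funM => //; apply: measurable_indic;
      exact: measurableD.
  - apply/measurable_EFinP; apply: measurable_funM => //.
    by apply: (measurable_indic mA2).
  - move=> w _; rewrite -EFinM lee_fin !indicE.
    case: (boolP (w \in A2 `\` far)) => [/set_mem [wA wf]|_]; last first.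
      by rewrite mulr0 mulr_ge0// expR_ge0.
    rewrite mulr1 mem_set// mul1r ler_expR lerN2 leNgt; exact/negP.
move: cover markov low.
have fP B : measurable B -> P B = (fine (P B))%:E.
  by move=> mB; rewrite fineK// fin_num_measure.
have fP' B : measurable B -> P' B = (fine (P' B))%:E.
  by move=> mB; rewrite fineK// fin_num_measure.
rewrite (fP A1)// (fP far)// (fP (A2 `\` far)); last exact: measurableD.
rewrite (fP' A2)// -!EFinD -EFinM !lee_fin.
have p0 : 0 <= fine (P A1) by rewrite fine_ge0.
have e0 := expR_ge0 (- kappa).
have e1 : expR (- kappa) <= 1 by rewrite -[leRHS]expR0 ler_expR oppr_le0 ltW.
move: (fine (P A1)) (fine (P far)) (fine (P (A2 `\` far))) (fine (P' A2))
  (expR (- kappa)) p0 e0 e1 => p f q p' e p0 e0 e1 h1 h2 h3.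
by nra.
Qed.

End two_points.

(** * Hawkes processes *)

Lemma lebesgue_integral_translate (R : realType) (a : R) (f : R -> \bar R) :
  measurable_fun setT f -> (forall x, 0 <= f x)%E ->
  (\int[lebesgue_measure]_s f (s - a)%R = \int[lebesgue_measure]_s f s)%E.
Proof.
move=> mf f0.
have mphi : measurable_fun setT (fun s : measurableTypeR R => s - a : measurableTypeR R).
  exact: measurable_funB.
have := @ge0_integral_pushforward _ _ _ _ R _ mphi (@lebesgue_measure R) setT f measurableT mf.
rewrite preimage_setT => <- //.
pose phi := (fun s : measurableTypeR R => s - a : measurableTypeR R).
pose mixin := isMeasurableFun.Build _ _ _ _ _ mphi.
pose pack : {mfun measurableTypeR R >-> measurableTypeR R} := HB.pack phi mixin.
apply: eq_measure_integral => A mA _.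
apply/esym/(@lebesgue_measure_unique _ (pushforward lebesgue_measure pack)) => //= _ [[x y]] _ <-.
rewrite /pushforward /=.
have -> : phi @^-1` `]x, y]%classic = `]x + a, y + a]%classic.
  by apply/seteqP; split => s /=; rewrite !in_itv/= /phi ltrBrDr lerBlDr.
rewrite !lebesgue_measure_itv/= !lte_fin ltrD2r.
by case: ifP => // _; rewrite -!EFinD; congr EFin; lra.
Qed.

Lemma measurable_capped (R : realType) (s0 : R) (h : R * config R -> R) (n : nat) :
  measurable_fun setT (h : past R s0 -> R) ->
  measurable_fun setT
    ((fun x => (if (nbefore s0 x.1 x.2 < n)%N then h x else 0)%:E) : past R s0 -> \bar R).
Proof.
move=> mh; pose D : set (past R s0) := [set x | (n <= nbefore s0 x.1 x.2)%N].
have mD : measurable (~` D).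
  apply: measurableC; rewrite {}/D; case: n => [|k]; last exact: predictable_nbefore_gt.
  by rewrite (_ : [set _ | _] = setT)//; apply/seteqP; split.
rewrite (_ : (fun x => _) = (EFin \o h : past R s0 -> \bar R) \_ (~` D)).
  apply/(measurable_restrictT _ mD); apply: measurable_funTS; exact/measurable_EFinP.
apply/funext => x; rewrite patchE ltnNge.
rewrite (_ : (x \in ~` D) = ~~ (n <= nbefore s0 x.1 x.2)%N); last first.
  by apply/idP/idP => [/set_mem/negP//|/negP ?]; apply/mem_set.
by case: ifP.
Qed.

Lemma measurable_capped_path (R : realType) (s0 : R) (h : R * config R -> R)
    (n : nat) (w : config R) :
  measurable_fun setT (h : past R s0 -> R) ->
  measurable_fun setT (fun s => (if (nbefore s0 s w < n)%N then h (s, w) else 0)%:E).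
Proof.
move=> mh.
exact: (measurable_fun_pair1 w (predictable_measurable (measurable_capped n mh))).
Qed.

Section hawkes_intensity.
Context {R : realType} (g : R -> R).
Hypothesis hg : kernel_shape g.

(** Extending the kernel by zero to negative arguments makes it nonnegative and
    measurable everywhere. *)
Let G : R -> R := g \_ `[0, +oo[.

Let G0 x : 0 <= G x.
Proof.
rewrite /G patchE; case: ifPn => // /set_mem; rewrite /= in_itv/= andbT.
by case: hg => _ g0 _ /g0.
Qed.

Let mG : measurable_fun setT G.
Proof. by apply/(measurable_restrictT _ (measurable_itv _)); case: hg. Qed.

Let intG a : (\int[lebesgue_measure]_s (G (s - a)%R)%:E = 1)%E.
Proof.
rewrite (@lebesgue_integral_translate R a (EFin \o G)); last 2 first.
- exact/measurable_EFinP.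
- by move=> x; rewrite lee_fin.
case: hg => _ _ <-; rewrite [RHS]integral_mkcond; apply: eq_integral => s _.
by rewrite /= /G !patchE; case: ifP.
Qed.

Definition excitation (s0 : R) (x : R * config R) : R :=
  \sum_(k < nbefore s0 x.1 x.2) G (x.1 - arrival s0 k x.2).

Lemma excitation_ge0 s0 x : 0 <= excitation s0 x.
Proof. by apply: sumr_ge0. Qed.

Lemma hawkes_intensityE (mu rho s0 : R) (x : R * config R) :
  hawkes_intensity mu rho g s0 x = (mu + rho * excitation s0 x)%:E.
Proof.
rewrite /hawkes_intensity EFinD EFinM; congr (_ + _ * _)%E.
rewrite /excitation -(@pp_integral_arrivals _ s0 x.1 x.2 (fun s => G (x.1 - s)))//.
apply: eq_esum => s [_]; rewrite /= in_itv/= => /andP[_ sx]; congr EFin.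
by rewrite /G patchE mem_set//= in_itv/= andbT subr_ge0 ltW.
Qed.

Section excitation_path.
Variables (s0 T : R).
Hypothesis mexc : measurable_fun setT (excitation s0 : past R s0 -> R).

(** While fewer than [n] points have occurred, only the first [n] points
    excite, and each of them by at most the total mass of the kernel. *)
Lemma integral_excitation (n : nat) (w : config R) :
  (\int[lebesgue_measure]_(s in `]s0, T[)
     (if (nbefore s0 s w < n)%N then excitation s0 (s, w) else 0)%:E <=
   (minn (nbefore s0 T w) n)%:R%:E)%E.
Proof.
set m := minn _ _.
have mGs k : measurable_fun setT (fun s : R => (G (s - arrival s0 k w))%:E).
  apply/measurable_EFinP; apply: (measurableT_comp mG).
  exact: measurable_funB.
apply: (@le_trans _ _ (\int[lebesgue_measure]_s
    (\sum_(k < m) (G (s - arrival s0 k w)%R)%:E))%E); last first.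
  rewrite ge0_integral_sum//; [|by move=> k; exact: mGs|by move=> k s _; rewrite lee_fin].
  under eq_bigr do rewrite intG.
  by rewrite sumEFin lee_fin sumr_const card_ord.
rewrite integral_mkcond; apply: ge0_le_integral => //.
- move=> s _; rewrite patchE; case: ifP => // _; rewrite lee_fin.
  by case: ifP => // _; exact: excitation_ge0.
- apply/(measurable_restrictT _ (measurable_itv _)); apply: measurable_funTS.
  exact: measurable_capped_path mexc.
- by apply: emeasurable_sum => k; exact: mGs.
- move=> s _; rewrite sumEFin patchE.
  have S0 k : 0 <= \sum_(i < k) G (s - arrival s0 i w) by exact: sumr_ge0.
  case: ifPn => [/set_mem|_]; last by rewrite lee_fin.
  rewrite /= in_itv/= => /andP[_ sT]; rewrite lee_fin; case: ifPn => [sn|_]; last exact: S0.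
  have sm : (nbefore s0 s w <= m)%N by rewrite leq_min (le_nbefore _ _ (ltW sT)) ltnW.
  rewrite /excitation /= (big_ord_widen m (fun k => G (s - arrival s0 k w)) sm).
  by rewrite big_mkcond; apply: ler_sum => k _; case: ifP => // _; exact: G0.
Qed.

End excitation_path.
End hawkes_intensity.

Section hawkes_model_intensity.
Context {R : realType} (P : probability (config R) R) (mu rho s0 : R) (g : R -> R).
Hypothesis mu0 : 0 < mu.
Hypothesis rho01 : 0 < rho < 1.
Hypothesis hg : kernel_shape g.
Hypothesis hP : is_hawkes mu rho g s0 P.

Definition hawkes_rate (x : R * config R) : R := mu + rho * excitation g s0 x.

Lemma predictable_rate : measurable_fun setT (hawkes_rate : past R s0 -> R).
Proof.
have [_ [_ ml _ _]] := hP.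
apply/measurable_EFinP; apply: eq_measurable_fun ml => x _.
exact: hawkes_intensityE.
Qed.

Lemma predictable_excitation :
  measurable_fun setT (excitation g s0 : past R s0 -> R).
Proof.
have /andP[rho0 _] := rho01; have mrate := predictable_rate.
rewrite (_ : excitation g s0 = fun x => (hawkes_rate x - mu) * rho^-1).
  by apply: measurable_funM => //; exact: measurable_funB.
by apply/funext => x; rewrite /hawkes_rate addrC addKr mulrC mulKf// gt_eqF.
Qed.

Lemma integral_rate_capped (n : nat) (T : R) (w : config R) : s0 <= T ->
  (\int[lebesgue_measure]_(s in `]s0, T[)
     (if (nbefore s0 s w < n)%N then hawkes_rate (s, w) else 0)%:E <=
   (mu * (T - s0) + rho * (minn (nbefore s0 T w) n)%:R)%:E)%E.
Proof.
move=> s0T; have /andP[rho0 _] := rho01.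
pose e s := if (nbefore s0 s w < n)%N then excitation g s0 (s, w) else 0.
have e0 s : 0 <= e s by rewrite /e; case: ifP => // _; exact: excitation_ge0.
have me : measurable_fun setT (fun s => (e s)%:E).
  exact: measurable_capped_path predictable_excitation.
apply: (@le_trans _ _ (\int[lebesgue_measure]_(s in `]s0, T[)
   (mu%:E + rho%:E * (e s)%:E))%E).
  apply: ge0_le_integral => //.
  - move=> s _; rewrite lee_fin; case: ifP => // _.
    by rewrite addr_ge0 ?mulr_ge0 ?excitation_ge0// ltW.
  - by apply: measurable_funTS; exact: measurable_capped_path predictable_rate.
  - apply: emeasurable_funD => //; apply: measurable_funeM; exact: measurable_funTS.
  - move=> s _; rewrite -EFinM -EFinD lee_fin /e; case: ifP => // _.
    by rewrite mulr0 addr0 ltW.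
have mu_ge0 s : `]s0, T[%classic s -> (0 <= mu%:E)%E by rewrite lee_fin ltW.
have re_ge0 s : `]s0, T[%classic s -> (0 <= rho%:E * (e s)%:E)%E.
  by rewrite -EFinM lee_fin mulr_ge0// ltW.
have mre : measurable_fun `]s0, T[ (fun s => rho%:E * (e s)%:E)%E.
  by apply: measurable_funeM; exact: measurable_funTS.
rewrite ge0_integralD//.
rewrite EFinD; apply: leeD.
  have leb : lebesgue_measure (`]s0, T[%classic : set R) = (T - s0)%:E.
    rewrite lebesgue_measure_itv/= lte_fin; case: ltP => [//|Ts0].
    by rewrite (_ : T - s0 = 0)//; apply/eqP; rewrite subr_eq0 eq_le Ts0.
  rewrite integral_cst// [X in (_ * X)%E](_ : _ = (T - s0)%:E); last exact: leb.
  by rewrite EFinM.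
have e_ge0 s : `]s0, T[%classic s -> (0 <= (e s)%:E)%E by rewrite lee_fin.
have meT : measurable_fun `]s0, T[ (fun s => (e s)%:E) by exact: measurable_funTS.
rewrite ge0_integralZl_EFin//; last exact: ltW.
rewrite EFinM lee_wpmul2l ?lee_fin ?(ltW rho0)//.
by apply: (integral_excitation hg) => //; exact: predictable_excitation.
Qed.

Lemma integral_rate (T : R) (w : config R) : s0 <= T ->
  (\int[lebesgue_measure]_(s in `]s0, T[) (hawkes_rate (s, w))%:E <=
   (mu * (T - s0) + rho * (nbefore s0 T w)%:R)%:E)%E.
Proof.
move=> s0T; have := integral_rate_capped (nbefore s0 T w).+1 w s0T.
rewrite (minn_idPl (leqnSn _)); apply: le_trans.
rewrite le_eqVlt; apply/orP; left; apply/eqP; apply: eq_integral => s /set_mem.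
by rewrite /= in_itv/= => /andP[_ sT]; rewrite ltnS le_nbefore// ltW.
Qed.

(** The kernel has mass one and [rho < 1], so each point adds at most one to
    the integrated intensity. *)
Lemma hawkes_bounded_intensity : bounded_intensity P s0 mu hawkes_rate.
Proof.
have /andP[rho0 rho1] := rho01.
split=> //.
- by move=> x; rewrite lerDl mulr_ge0 ?(excitation_ge0 hg)// ltW.
- exact: predictable_rate.
- move=> t w w' ww'; suff : (hawkes_rate (t, w))%:E = (hawkes_rate (t, w'))%:E by case.
  by rewrite -!(hawkes_intensityE hg) /hawkes_intensity /pp_integral /= ww'.
- move=> T w s0T; apply: le_trans (integral_rate w s0T) _.
  by rewrite lee_fin lerD2l ler_piMl// ltW.
- move=> C C0 mC; have [_ [_ _ _ brem]] := hP.
  have rateE : hawkes_intensity mu rho g s0 = EFin \o hawkes_rate.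
    by apply/funext => x; exact: hawkes_intensityE.
  by rewrite (brem C C0 mC) rateE.
Qed.

Lemma measurable_nbefore (T : R) :
  measurable_fun setT (fun w => (nbefore s0 T w)%:R%:E : \bar R).
Proof.
under eq_fun do rewrite -npoints_before.
exact: measurable_npoints.
Qed.

Lemma sum_ord_lt (N n : nat) :
  \sum_(k < N) (if (k < n)%N then 1 else 0) = (minn N n)%:R :> R.
Proof.
elim: N => [|N IH]; first by rewrite big_ord0 min0n.
rewrite big_ord_recr/= IH; case: ltnP => h.
  by rewrite (minn_idPl h) natr1.
by rewrite (minn_idPr (leqW h)) addr0.
Qed.

Let measurable_nbefore_min (n : nat) (T : R) :
  measurable_fun setT (fun w => (minn (nbefore s0 T w) n)%:R%:E : \bar R).
Proof.
rewrite (_ : (fun w => _) = fun w => mine ((nbefore s0 T w)%:R%:E) n%:R%:E).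
  by apply: measurable_mine => //; exact: measurable_nbefore.
apply/funext => w; rewrite /mine lte_fin ltr_nat /minn.
by case: ifP.
Qed.

(** Applying the intensity to the process stopped at its [n]-th point keeps
    all expectations finite, so that the term in [rho] can be moved to the
    left-hand side. *)
Lemma mean_count_capped (n : nat) (T : R) : s0 <= T ->
  (\int[P]_w (minn (nbefore s0 T w) n)%:R%:E <=
   (mu * (T - s0) / (1 - rho))%:E)%E.
Proof.
move=> s0T; have /andP[rho0 rho1] := rho01.
pose C (x : R * config R) : R := if (nbefore s0 x.1 x.2 < n)%N then 1 else 0.
have C0 x : 0 <= C x by rewrite /C; case: ifP.
have mC : measurable_fun ([set x | s0 < x.1 < T] : set (past R s0)) (EFin \o C).
  apply: measurable_funTS; exact: (@measurable_capped R s0 (cst 1) n).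
have := local_intensity (lam := EFin \o hawkes_rate)
  (bi_intensity hawkes_bounded_intensity)
  (fun x => C0 x : (0 <= (C x)%:E)%E) mC.
rewrite (_ : (fun w => pp_integral _ _ w) =
    (fun w => (minn (nbefore s0 T w) n)%:R%:E)); last first.
  apply/funext => w; rewrite (@pp_integral_arrivals _ s0 T w (fun s => C (s, w)))//.
  congr EFin; rewrite /C /= -sum_ord_lt; apply: eq_bigr => k _.
  by have [_ _ _ ->] := arrivalP (ltn_ord k).
set m := (\int[P]_w (minn _ _)%:R%:E)%E => countE.
have mmin := measurable_nbefore_min n T.
have m_fin : m \is a fin_num.
  rewrite ge0_fin_numE; last by apply: integral_ge0.
  apply: (@le_lt_trans _ _ (\int[P]_w (cst n%:R%:E w))%E).
    by apply: ge0_le_integral => // w _; rewrite lee_fin ler_nat geq_minr.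
  rewrite integral_cst// [X in (_ * X)%E](_ : _ = 1%E); last exact: probability_setT.
  by rewrite mule1 ltry.
have : (m <= (mu * (T - s0))%:E + rho%:E * m)%E.
  rewrite {1}countE.
  apply: (@le_trans _ _ (\int[P]_w ((mu * (T - s0))%:E +
      rho%:E * (minn (nbefore s0 T w) n)%:R%:E))%E).
    have rate0 x : 0 <= hawkes_rate x.
      by rewrite addr_ge0 ?mulr_ge0 ?(excitation_ge0 hg)// ltW.
    have capE w : (\int[lebesgue_measure]_(t in `]s0, T[)
        ((C (t, w))%:E * (EFin \o hawkes_rate) (t, w)) =
        \int[lebesgue_measure]_(s in `]s0, T[)
        (if (nbefore s0 s w < n)%N then hawkes_rate (s, w) else 0)%:E)%E.
      apply: eq_integral => s _; rewrite /C /= -EFinM; congr EFin.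
      by case: ifP => _; rewrite ?mul1r ?mul0r.
    under eq_integral do rewrite capE.
    apply: ge0_le_integral => //.
    - move=> w _; apply: integral_ge0 => s _; rewrite lee_fin.
      by case: ifP => // _.
    - have cap0 x : (0 <= (if (nbefore s0 x.1 x.2 < n)%N then hawkes_rate x else 0)%:E)%E.
        by rewrite lee_fin; case: ifP.
      exact: (measurable_fun_pair2 T (predictable_measurable
        (predictable_integral cap0 (measurable_capped n predictable_rate)))).
    - by apply: emeasurable_funD => //; exact: measurable_funeM.
    - by move=> w _; rewrite -EFinM -EFinD; exact: integral_rate_capped.
  have cst0 w : [set: config R] w -> (0 <= (mu * (T - s0))%:E)%E.
    by rewrite lee_fin mulr_ge0 ?subr_ge0// ltW.
  have min0 w : [set: config R] w -> (0 <= rho%:E * (minn (nbefore s0 T w) n)%:R%:E)%E.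
    by rewrite -EFinM lee_fin mulr_ge0// ltW.
  have mrmin : measurable_fun setT (fun w => rho%:E * (minn (nbefore s0 T w) n)%:R%:E)%E.
    exact: measurable_funeM.
  rewrite ge0_integralD// ge0_integralZl_EFin//; last exact: ltW.
  apply: leeD => //.
  rewrite integral_cst// [X in (_ * X)%E](_ : _ = 1%E); last exact: probability_setT.
  by rewrite mule1.
move: m_fin; case: m {countE} => [r| |]// _; rewrite -EFinM -EFinD !lee_fin => h.
by rewrite ler_pdivlMr ?subr_gt0//; lra.
Qed.

(** The mean of a branching process with immigration rate [mu] and mean number
    of offspring [rho]. *)
Lemma mean_count (T : R) : s0 <= T ->
  (\int[P]_w (nbefore s0 T w)%:R%:E <= (mu * (T - s0) / (1 - rho))%:E)%E.
Proof.
move=> s0T; pose c n w : \bar R := (minn (nbefore s0 T w) n)%:R%:E.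
have cvg_c w : c n w @[n --> \oo] --> (nbefore s0 T w)%:R%:E.
  apply: cvg_near_cst; exists (nbefore s0 T w) => // n /= nT.
  by rewrite /c (minn_idPl nT).
rewrite (_ : (\int[P]_w _)%E = (\int[P]_w limn (c ^~ w))%E); last first.
  by apply: eq_integral => w _; apply/esym/cvg_lim.
have mc n : measurable_fun setT (c n) by exact: measurable_nbefore_min.
have c0 n w : [set: config R] w -> (0 <= c n w)%E by rewrite /c lee_fin.
have ndc w : [set: config R] w -> nondecreasing_seq (c ^~ w).
  move=> _ a b ab; rewrite /c lee_fin ler_nat leq_min geq_minl.
  by rewrite (leq_trans (geq_minr _ _) ab).
rewrite monotone_convergence//; apply: lime_le.
  apply: ereal_nondecreasing_is_cvgn => a b ab.
  by apply: ge0_le_integral => // w Tw; [exact: c0|exact: ndc].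
by apply: nearW => n; exact: mean_count_capped.
Qed.

Lemma excitation_mean (T : R) : s0 <= T ->
  (\int[P]_w \int[lebesgue_measure]_(s in `]s0, T[) (excitation g s0 (s, w))%:E <=
   (mu * (T - s0) / (1 - rho))%:E)%E.
Proof.
move=> s0T; apply: le_trans (mean_count s0T).
have e0 x : (0 <= (excitation g s0 x)%:E)%E by rewrite lee_fin excitation_ge0.
apply: ge0_le_integral => //.
- by move=> w _; apply: integral_ge0.
- have me : measurable_fun setT ((fun x => (excitation g s0 x)%:E) : past R s0 -> \bar R).
    by apply/measurable_EFinP; exact: predictable_excitation.
  exact: (measurable_fun_pair2 T (predictable_measurable (predictable_integral e0 me))).
- exact: measurable_nbefore.
move=> w _; have := @integral_excitation _ _ hg s0 T predictable_excitation
  (nbefore s0 T w).+1 w.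
rewrite (minn_idPl (leqnSn _)); apply: le_trans.
rewrite le_eqVlt; apply/orP; left; apply/eqP; apply: eq_integral => s /set_mem.
by rewrite /= in_itv/= => /andP[_ sT]; rewrite ltnS le_nbefore// ltW.
Qed.

Lemma cumul_mean (T : R) : s0 <= T ->
  (\int[P]_w (cumul s0 hawkes_rate T w)%:E < +oo)%E.
Proof.
move=> s0T; have bi := hawkes_bounded_intensity.
have rate0 x : 0 <= hawkes_rate x by exact: ltW (lt_le_trans mu0 (bi_ge bi x)).
apply: (@le_lt_trans _ _ (\int[P]_w ((mu * (T - s0))%:E + (nbefore s0 T w)%:R%:E))%E).
  apply: ge0_le_integral => //.
  - by move=> w _; rewrite lee_fin fine_ge0// integral_ge0// => s _; rewrite lee_fin.
  - apply/measurable_EFinP; exact: measurable_cumul predictable_rate.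
  - by apply: emeasurable_funD => //; exact: measurable_nbefore.
  - move=> w _; rewrite -EFinD /cumul fineK; first exact: bi_integral bi _ _ s0T.
    rewrite ge0_fin_numE; last by apply: integral_ge0 => s _; rewrite lee_fin.
    by apply: le_lt_trans (bi_integral bi w s0T) _; rewrite ltry.
have cst0 w : [set: config R] w -> (0 <= (mu * (T - s0))%:E)%E.
  by rewrite lee_fin mulr_ge0 ?subr_ge0// ltW.
have mN := measurable_nbefore T.
rewrite ge0_integralD// integral_cst//.
rewrite [X in (_ * X)%E](_ : _ = 1%E); last exact: probability_setT.
rewrite mule1; apply: lte_add_pinfty; first exact: ltry.
by apply: le_lt_trans (mean_count s0T) _; rewrite ltry.
Qed.

End hawkes_model_intensity.

(** Both intensities are affine in the same excitation [y], and
    [((rho - rho') * y) ^+ 2 / (mu + rho' * y) <= (rho - rho') ^+ 2 / rho' * y]. *)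
Lemma hawkes_entropy (R : realType) (P : probability (config R) R)
    (mu rho rho' s0 T : R) (g : R -> R) :
  0 < mu -> 0 < rho < 1 -> 0 < rho' -> kernel_shape g ->
  is_hawkes mu rho g s0 P -> s0 <= T ->
  (\int[P]_w \int[lebesgue_measure]_(s in `]s0, T[)
     ((hawkes_rate mu rho s0 g (s, w) - hawkes_rate mu rho' s0 g (s, w)) ^+ 2 /
       hawkes_rate mu rho' s0 g (s, w))%:E <=
   ((rho - rho') ^+ 2 / rho' * (mu * (T - s0) / (1 - rho)))%:E)%E.
Proof.
move=> mu0 rho01 rho'0 hg hP s0T; have /andP[rho0 rho1] := rho01.
pose k := (rho - rho') ^+ 2 / rho'.
have k0 : 0 <= k by rewrite divr_ge0 ?sqr_ge0// ltW.
have mexc := predictable_excitation rho01 hg hP.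
have e0 := excitation_ge0 hg s0.
have rate'_gt0 x : 0 < hawkes_rate mu rho' s0 g x.
  by rewrite ltr_wpDr// mulr_ge0// ltW.
have mrate r : measurable_fun setT (hawkes_rate mu r s0 g : past R s0 -> R).
  by apply: measurable_funD => //; exact: measurable_funM.
pose D x := (hawkes_rate mu rho s0 g x - hawkes_rate mu rho' s0 g x) ^+ 2 /
       hawkes_rate mu rho' s0 g x.
have D0 x : (0 <= (D x)%:E)%E by rewrite lee_fin divr_ge0 ?sqr_ge0// ltW.
have mD : measurable_fun setT ((fun x => (D x)%:E) : past R s0 -> \bar R).
  apply/measurable_EFinP; apply: measurable_funM.
    by apply: measurable_funX; exact: measurable_funB.
  by apply: measurable_inv_ge0 => // x; exact: ltW.
have mE : measurable_fun setT ((fun x => (excitation g s0 x)%:E) : past R s0 -> \bar R).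
  exact/measurable_EFinP.
have E0 x : (0 <= (excitation g s0 x)%:E)%E by rewrite lee_fin.
have Dle x : D x <= k * excitation g s0 x.
  rewrite /D ler_pdivrMr// /hawkes_rate /k.
  have := e0 x; move: (excitation g s0 x) => y y0.
  rewrite (_ : mu + rho * y - (mu + rho' * y) = (rho - rho') * y); last by lra.
  rewrite exprMn; move: (sqr_ge0 (rho - rho')); move: ((rho - rho') ^+ 2) => q q0.
  rewrite (_ : q / rho' * y * (mu + rho' * y) = q * y ^+ 2 + q / rho' * y * mu).
    by rewrite lerDl !mulr_ge0 ?invr_ge0// ltW.
  by field; rewrite gt_eqF.
rewrite EFinM.
apply: (@le_trans _ _ (k%:E * \int[P]_w \int[lebesgue_measure]_(s in `]s0, T[)
    (excitation g s0 (s, w))%:E)%E); last first.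
  by rewrite lee_wpmul2l// excitation_mean.
have mT (h : R * config R -> \bar R) : (forall x, (0 <= h x)%E) ->
    measurable_fun setT (h : past R s0 -> \bar R) ->
    measurable_fun setT (fun w => \int[lebesgue_measure]_(s in `]s0, T[) h (s, w))%E.
  move=> h0 mh.
  exact: (measurable_fun_pair2 T (predictable_measurable (predictable_integral h0 mh))).
have int0 w : [set: config R] w ->
    (0 <= \int[lebesgue_measure]_(s in `]s0, T[) (excitation g s0 (s, w))%:E)%E.
  by move=> _; apply: integral_ge0.
have mint := mT _ E0 mE.
rewrite -ge0_integralZl_EFin//.
apply: ge0_le_integral => //.
- by move=> w _; apply: integral_ge0 => s _; exact: D0.
- exact: mT D0 mD.
- exact: measurable_funeM.
move=> w _.
have es0 s : `]s0, T[%classic s -> (0 <= (excitation g s0 (s, w))%:E)%E by move=> _.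
have mes : measurable_fun `]s0, T[ (fun s => (excitation g s0 (s, w))%:E).
  apply: measurable_funTS; exact: (measurable_fun_pair1 w (predictable_measurable mE)).
rewrite -ge0_integralZl_EFin//.
apply: ge0_le_integral => //.
- by move=> s _; exact: D0.
- by apply: measurable_funTS; exact: (measurable_fun_pair1 w (predictable_measurable mD)).
- exact: measurable_funeM.
by move=> s _; rewrite -EFinM lee_fin; exact: Dle.
Qed.

(** * Estimators *)

Lemma config_eq (R : realType) (w w' : config R) : points w = points w' -> w = w'.
Proof.
case: w w' => [A fA] [B fB] /= AB; move: fA fB; rewrite AB => fA fB.
by congr Config; exact: Prop_irrelevance.
Qed.

Lemma measurable_restrict_config (R : realType) (D : set R) :
  measurable D -> measurable_fun setT (@restrict_config R D).
Proof.
move=> mD; apply: (@measurability _ _ (config R) (config R) setT _ (count_events setT)) => //.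
move=> _ [_ [B [mB _]] [C mC <-] <-]; rewrite !setTI.
rewrite [X in measurable X](_ : _ = npoints (D `&` B) @^-1` C).
  by rewrite -[X in measurable X]setTI; exact: (measurable_npoints (measurableI _ _ mD mB) measurableT mC).
by apply/seteqP; split => w; rewrite /= /npoints /= setIA.
Qed.

Lemma measurable_rel_error (R : realType) (T : R) (rhohat : config R -> R)
    (M : hawkes_model R) :
  measurable_fun setT rhohat -> measurable_fun setT (rel_error T rhohat M).
Proof.
move=> mr; apply: (measurableT_comp (@normr_measurable R setT)).
apply: measurable_funB => //; apply: measurable_funM => //.
apply: measurable_funB => //.
by apply: (measurableT_comp mr); exact: measurable_restrict_config.
Qed.

(** Almost surely there is no point at or before [s0], so the record on [0, T]
    is a function of the points strictly between [s0] and any later time. *)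
Lemma law_record_le (R : realType) (P : probability (config R) R) (s0 T S : R)
    (A : set (config R)) :
  s0 <= 0 -> T < S -> {ae P, forall w, points w `&` `]-oo, s0] = set0} ->
  measurable A ->
  (forall w w', restrict_config `[0, T] w = restrict_config `[0, T] w' -> A w -> A w') ->
  (P (record s0 S @^-1` A) <= P A)%E.
Proof.
move=> s00 TS [N [mN PN Nsub]] mA Aloc.
apply: (@le_trans _ _ (P (A `|` N))); last first.
  apply: (le_trans (measureU2 P mA mN)).
  by rewrite [X in (_ + X)%E](_ : _ = 0%E) ?adde0.
apply: le_measure; rewrite ?inE//.
- exact: record_measurable.
- exact: measurableU.
move=> w Aw; have [Nw|Nw] := pselect (N w); [by right|left].
have w0 : points w `&` `]-oo, s0] = set0 by apply: contra_notP Nw => h; exact: Nsub.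
apply: Aloc Aw; apply: config_eq; rewrite /=.
apply/seteqP; split => x /=; first by move=> [[]].
move=> [wx]; rewrite !in_itv/= => /andP[x0 xT]; split; last by rewrite x0.
split=> //; apply/andP; split; last exact: le_lt_trans TS.
rewrite ltNge; apply/negP => xs0; suff : set0 x by [].
by rewrite -w0; split => //=; rewrite in_itv/=.
Qed.

(** An estimate close to one margin is far from a margin that differs from it
    by the factor [1 + delta]. *)
Lemma margin_separation (R : realType) (u delta e : R) :
  0 < delta <= 1 -> 3 * e = delta -> `|u - 1| < e -> e <= `|u / (1 + delta) - 1|.
Proof.
move=> /andP[d0 d1] de; rewrite ltr_norml => /andP[_ ue].
have d2 : 0 < 1 + delta by lra.
rewrite -normrN ler_normr; apply/orP; left.
rewrite opprB lerBrDr -lerBrDl ler_pdivrMr//; nra.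
Qed.

Section minimax.
Context {R : realType} (c r : R).
Hypothesis hc : 0 <= c.
Hypothesis hr : 0 < r.

(** The relative entropy of the perturbation used below stays under this bound
    whatever the information is. *)
Definition entropy_bound : R := r * (2 + c) / 2.

Lemma entropy_bound_ge0 : 0 <= entropy_bound.
Proof.
by rewrite /entropy_bound divr_ge0// mulr_ge0 ?addr_ge0// ltW.
Qed.

(** The perturbation is [delta = r / 2 * eta], where [eta] is the minimum of 1 and
    the inverse square root of the information: [r / 2] keeps the perturbed
    branching ratio above [r / 2], and [eta ^+ 2] compensates the information in
    the entropy. The radius is a third of [delta], as [margin_separation]
    requires. *)
Lemma minimax_lower_bound (mu T rho0 : R) (g : R -> R) (F : set (hawkes_model R))
    (rhohat : config R -> R) :
  0 < mu -> 0 < T -> r <= rho0 -> rho0 < 1 -> kernel_shape g ->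
  contains_local_perturbations F mu rho0 g (- (c * T)) ->
  measurable_fun setT rhohat ->
  ((expR (- (2 * (entropy_bound + 1))) / 4)%:E <= sup_prob F (fun M => [set w |
     (r / 6 * Num.min 1 (Num.sqrt (information T mu rho0))^-1
        <= rel_error T rhohat M w)%R]))%E.
Proof.
move=> mu0 T0 rrho rho1 hg [hF hpert] mrh.
set I := information T mu rho0; set eta := Num.min 1 _.
have I0 : 0 < I by rewrite /I /information !mulr_gt0// subr_gt0.
have sI0 : 0 < Num.sqrt I by rewrite sqrtr_gt0.
have eta0 : 0 < eta by rewrite lt_min ltr01 invr_gt0.
have eta1 : eta <= 1 by rewrite ge_min lexx.
have etaI : eta ^+ 2 * I <= 1.
  have : eta <= (Num.sqrt I)^-1 by rewrite ge_min lexx orbT.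
  rewrite -(ler_pM2r sI0) mulVf ?gt_eqF// => h.
  have -> : eta ^+ 2 * I = (eta * Num.sqrt I) ^+ 2 by rewrite exprMn sqr_sqrtr// ltW.
  by rewrite expr_le1// mulr_ge0// ltW.
have rlt1 : r < 1 by exact: le_lt_trans rho1.
pose delta := r / 2 * eta.
have d0 : 0 < delta by rewrite /delta mulr_gt0// divr_gt0.
have dr : delta <= r / 2 by rewrite /delta ler_piMr// divr_ge0// ltW.
pose rho' := 1 - (1 + delta) * (1 - rho0).
have rho'E : 1 - rho' = (1 + delta) * (1 - rho0) by rewrite /rho' opprB addrC subrK.
have rho'r : r / 2 <= rho' by rewrite /rho'; nra.
have rho'0 : 0 < rho' by apply: lt_le_trans rho'r; rewrite divr_gt0.
have rho0rho' : rho0 - rho' = delta * (1 - rho0) by rewrite /rho'; lra.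
have rho'1 : rho' < 1 by rewrite -subr_gt0 rho'E mulr_gt0 ?subr_gt0// addr_gt0.
have rho00 : 0 < rho0 by exact: lt_le_trans rrho.
have d01 : 0 < delta <= 1 / 2 by rewrite d0 /=; lra.
have [M0 FM0 [mu_M0 rho_M0 g_M0 s_M0]] := hF.
have [M1 FM1 [mu_M1 rho_M1 g_M1 s_M1]] := hpert rho' delta d01 rho'0 rho'E.
pose s0 := - (c * T).
have h0 := hm_hawkes M0; rewrite mu_M0 rho_M0 g_M0 s_M0 -/s0 in h0.
have h1 := hm_hawkes M1; rewrite mu_M1 rho_M1 g_M1 s_M1 -/s0 in h1.
have s00 : s0 <= 0 by rewrite /s0 oppr_le0 mulr_ge0// ltW.
(* a horizon beyond [T], since only points strictly before it are observed *)
pose S := 2 * T.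
have TS : T < S by rewrite /S; lra.
have s0S : s0 <= S by apply: (le_trans s00); rewrite /S; lra.
have rho01 : 0 < rho0 < 1 by rewrite rho00.
have rho'01 : 0 < rho' < 1 by rewrite rho'0.
have b0 := hawkes_bounded_intensity mu0 rho01 hg h0.
have b1 := hawkes_bounded_intensity mu0 rho'01 hg h1.
pose A0 := [set w | r / 6 * eta <= rel_error T rhohat M0 w].
pose A1 := [set w | r / 6 * eta <= rel_error T rhohat M1 w].
have mA M : measurable [set w | r / 6 * eta <= rel_error T rhohat M w].
  rewrite (_ : [set w | _] = rel_error T rhohat M @^-1` `[r / 6 * eta, +oo[%classic).
    by rewrite -[X in measurable X]setTI; apply: (measurable_rel_error T M mrh).
  by apply/seteqP; split => w /=; rewrite in_itv/= andbT.
have loc M w w' : restrict_config `[0, T] w = restrict_config `[0, T] w' ->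
    rel_error T rhohat M w = rel_error T rhohat M w'.
  by rewrite /rel_error => ->.
have le_rate x : hawkes_rate mu rho' s0 g x <= hawkes_rate mu rho0 s0 g x.
  rewrite lerD2l ler_wpM2r ?(excitation_ge0 hg)// -subr_ge0 rho0rho'.
  by rewrite mulr_ge0 ?subr_ge0// ltW.
have entropy : (\int[hm_law M0]_w \int[lebesgue_measure]_(s in `]s0, S[)
     ((hawkes_rate mu rho0 s0 g (s, w) - hawkes_rate mu rho' s0 g (s, w)) ^+ 2 /
       hawkes_rate mu rho' s0 g (s, w))%:E <= entropy_bound%:E)%E.
  apply: le_trans (hawkes_entropy mu0 rho01 rho'0 hg h0 s0S) _; rewrite lee_fin.
  rewrite rho0rho' /S /s0 /entropy_bound.
  have -> : (delta * (1 - rho0)) ^+ 2 / rho' *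
      (mu * (2 * T - - (c * T)) / (1 - rho0)) =
      (r / 2) ^+ 2 * (eta ^+ 2 * I) * (2 + c) / rho'.
    rewrite /delta /I /information; field.
    by rewrite gt_eqF//= gt_eqF// subr_gt0.
  rewrite ler_pdivrMr//.
  apply: (@le_trans _ _ ((r / 2) ^+ 2 * (2 + c))).
    rewrite ler_wpM2r ?addr_ge0// ler_piMr// sqr_ge0//.
  have -> : r * (2 + c) / 2 * rho' = r / 2 * rho' * (2 + c) by lra.
  by rewrite ler_wpM2r ?addr_ge0// expr2 ler_wpM2l// divr_ge0// ltW.
have bound := two_point_bound b0 b1 s0S le_rate entropy_bound_ge0 (mA M0)
  (cumul_mean mu0 rho01 hg h0 s0S) entropy.
have P0 : (hm_law M0 (record s0 S @^-1` A0) <= hm_law M0 A0)%E.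
  by apply: law_record_le s00 TS (proj1 h0) (mA M0) _ => w w' /loc /= ->.
have P1 : (hm_law M1 (record s0 S @^-1` (~` A0)) <= hm_law M1 A1)%E.
  apply: (@le_trans _ _ (hm_law M1 (record s0 S @^-1` A1))); last first.
    by apply: law_record_le s00 TS (proj1 h1) (mA M1) _ => w w' /loc /= ->.
  apply: le_measure; rewrite ?inE.
  - by apply: record_measurable; apply: measurableC; exact: mA.
  - by apply: record_measurable; exact: mA.
  move=> w /= /negP; rewrite -ltNge => err0.
  rewrite /A1 /= /rel_error rho_M1 rho'E.
  move: err0; rewrite /rel_error rho_M0; move: (1 - rhohat _) => v err0.
  have -> : v / ((1 + delta) * (1 - rho0)) = v / (1 - rho0) / (1 + delta).
    by rewrite invfM mulrA mulrAC.
  apply: margin_separation err0; first by rewrite d0 /=; lra.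
  by rewrite /delta; lra.
set P := sup_prob F _.
have S0 : (hm_law M0 A0 <= P)%E by apply: ereal_sup_ubound; exists M0.
have S1 : (hm_law M1 A1 <= P)%E by apply: ereal_sup_ubound; exists M1.
have : ((expR (- (2 * (entropy_bound + 1))) / 2)%:E <= P + P)%E.
  apply: le_trans bound _; apply: leeD.
    exact: le_trans P0 S0.
  exact: le_trans P1 S1.
case: P {S0 S1} => [p| |]; [|by move=> _; rewrite leey|by []].
by rewrite -EFinD !lee_fin; lra.
Qed.

End minimax.

Unset Implicit Arguments.

Theorem corollary2p3 (R : realType) (c r : R) (hc : 0 <= c) (hr : 0 < r) :
  (exists a b : R, 0 < a /\ 0 < b /\
    forall (mu T rho0 : R) (g : R -> R) (F : set (hawkes_model R)),
      0 < mu -> 0 < T -> r <= rho0 -> rho0 < 1 -> kernel_shape g ->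
      contains_local_perturbations F mu rho0 g (- (c * T)) ->
      forall rhohat : config R -> R, measurable_fun setT rhohat ->
        (b%:E <= sup_prob F (fun M => [set w |
           (a * Num.min 1 (Num.sqrt (information T mu rho0))^-1
             <= rel_error T rhohat M w)%R]))%E)
  /\
  (forall (mu T rho0 : nat -> R) (g : nat -> R -> R)
      (F : nat -> set (hawkes_model R)),
      (forall n, 0 < mu n) -> (forall n, 0 < T n) ->
      (forall n, r <= rho0 n) -> (forall n, rho0 n < 1) ->
      (forall n, kernel_shape (g n)) ->
      (forall n, contains_local_perturbations (F n) (mu n) (rho0 n) (g n)
                   (- (c * T n))) ->
      (exists B : R, forall n, information (T n) (mu n) (rho0 n) <= B) ->
      ~ exists rhohat : nat -> config R -> R,
          (forall n, measurable_fun setT (rhohat n)) /\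
          forall eps : R, 0 < eps ->
            (fun n => sup_prob (F n) (fun M => [set w |
               eps < rel_error (T n) (rhohat n) M w])) @ \oo --> 0%E).
Proof.
split.
  exists (r / 6), (expR (- (2 * (entropy_bound c r + 1))) / 4).
  split; first by rewrite divr_gt0.
  split; first by rewrite divr_gt0// expR_gt0.
  move=> mu T rho0 g F mu0 T0 rrho rho1 hg hF rhohat mrh.
  exact: (minimax_lower_bound hc hr mu0 T0 rrho rho1 hg hF mrh).
move=> mu T rho0 g F mu0 T0 rrho rho1 hg hF [B hB] [rhohat [mrh consistent]].
set b := expR (- (2 * (entropy_bound c r + 1))) / 4.
have b0 : 0 < b by rewrite divr_gt0// expR_gt0.
pose eta := Num.min 1 (Num.sqrt (Num.max B 1))^-1.
have B1 : 0 < Num.max B 1 by rewrite lt_max ltr01 orbT.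
have eta0 : 0 < eta by rewrite lt_min ltr01 invr_gt0 sqrtr_gt0.
have a0 : 0 < r / 6 * eta by rewrite mulr_gt0// divr_gt0.
have eps0 : 0 < r / 6 * eta / 2 by rewrite divr_gt0.
have lower n : (b%:E <= sup_prob (F n) (fun M => [set w |
     (r / 6 * eta / 2 < rel_error (T n) (rhohat n) M w)%R]))%E.
  apply: le_trans (minimax_lower_bound hc hr (mu0 n) (T0 n) (rrho n) (rho1 n)
    (hg n) (hF n) (mrh n)) _.
  apply: ge_ereal_sup => _ [M FM <-].
  have merr (i : interval R) :
      measurable (rel_error (T n) (rhohat n) M @^-1` [set` i]).
    by rewrite -[X in measurable X]setTI; apply: (measurable_rel_error (T n) M (mrh n)).
  apply: (@le_trans _ _ (hm_law M
      [set w | (r / 6 * eta / 2 < rel_error (T n) (rhohat n) M w)%R])); last first.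
    by apply: ereal_sup_ubound; exists M.
  apply: le_measure; rewrite ?inE.
  - have := merr `[r / 6 * Num.min 1 (Num.sqrt (information (T n) (mu n) (rho0 n)))^-1, +oo[.
    congr (measurable _); apply/seteqP; split => w /=; by rewrite in_itv/= andbT.
  - have := merr `]r / 6 * eta / 2, +oo[.
    congr (measurable _); apply/seteqP; split => w /=; by rewrite in_itv/= andbT.
  move=> w /=; apply: lt_le_trans.
  apply: (@lt_le_trans _ _ (r / 6 * eta)); first by rewrite ltr_pdivrMr// ltr_pMr// ltr1n.
  rewrite ler_wpM2l ?divr_ge0 ?(ltW hr)//.
  have I0 : 0 < information (T n) (mu n) (rho0 n).
    by rewrite /information !mulr_gt0// subr_gt0.
  rewrite le_min ge_min lexx/= ge_min; apply/orP; right.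
  rewrite lef_pV2 ?posrE ?sqrtr_gt0//.
  by apply: ler_wsqrtr; rewrite le_max hB.
have := consistent _ eps0 => lim0.
have : (b%:E <= 0)%E.
  rewrite -(cvg_lim _ lim0)//; apply: lime_ge; first by apply: cvgP lim0.
  exact: nearW.
by rewrite lee_fin leNgt b0.
Qed.
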